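(* Let $p$ be a prime, $n\in\{2,3\}$, $G\cong\mathbb{Z}_p^n$, and let $X=G\langle\sigma\rangle$ be a skew-product group of $G$ by a skew-morphism $\sigma$. Then (1) $X$ is isomorphic to a subgroup of $\mathrm{AGL}(n,p)$; (2) the number of skew-morphisms of $\mathbb{Z}_p^n$ is: for $p=2$, equal to $1$, $6$ and $168$ when $n=1,2,3$ respectively; for $p\neq 2$, equal to $p-1$, $2(p+1)(p-1)^3$ and $(p^3-1)(p^2-1)(p-1)(2p^3-3p^2+p+2)$ when $n=1,2,3$ respectively.
   Context: A skew-morphism of a finite group $G$ is a permutation $\sigma$ of $G$ fixing the identity such that there is an integer-valued function $\pi$ on $G$ with $\sigma(gh)=\sigma(g)\sigma^{\pi(g)}(h)$ for all $g,h\in G$. For $g\in G$ let $L_g:h\mapsto gh$. The skew-product group of $G$ by $\sigma$ is the permutation group $X=L_G\langle\sigma\rangle$ on $G$, with $G$ identified with $L_G$, so $X=G\langle\sigma\rangle$. *)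

(* Defs.v *)
From mathcomp Require Import all_boot all_order all_algebra all_fingroup.
From mathcomp Require Import boolp.

Set Implicit Arguments.
Unset Strict Implicit.
Unset Printing Implicit Defensive.

Import GroupScope.

Definition perm_expz (T : finType) (s : {perm T}) (z : int) : {perm T} :=
  match z with
  | Posz n => s ^+ n
  | Negz n => s ^- n.+1
  end.

(* The group G is the whole carrier of gT. *)
Definition skew_morphism (gT : finGroupType) (s : {perm gT}) : Prop :=
  s 1 = 1 /\
  exists pi : gT -> int,
    forall g h : gT, s (g * h) = s g * perm_expz s (pi g) h.

Definition skew_morphisms (gT : finGroupType) : {set {perm gT}} :=
  [set s | `[< skew_morphism s >]].

Definition left_mul_perm (gT : finGroupType) (g : gT) : {perm gT} :=
  perm (@mulgI gT g).

Definition left_regular (gT : finGroupType) : {set {perm gT}} :=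
  [set left_mul_perm g | g : gT].

(* Products of permutations compose from left to right: (s * t) x = t (s x).
   For a skew-morphism the two factors commute as sets, so the order of the
   product does not depend on the composition convention. *)
Definition skew_product (gT : finGroupType) (s : {perm gT}) : {set {perm gT}} :=
  left_regular gT * <[s]>.

Lemma left_regular_group_set (gT : finGroupType) : group_set (left_regular gT).
Proof.
apply/group_setP; split.
  by apply/imsetP; exists 1 => //; apply/permP => x; rewrite !permE mul1g.
move=> _ _ /imsetP[a _ ->] /imsetP[b _ ->]; apply/imsetP; exists (b * a) => //.
by apply/permP => x; rewrite !permE /= !permE mulgA.
Qed.

Canonical left_regular_group (gT : finGroupType) :=
  Group (left_regular_group_set gT).

Lemma perm_expz_cycle (T : finType) (s : {perm T}) (z : int) :
  perm_expz s z \in <[s]>.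
Proof. by case: z => n /=; rewrite ?groupV mem_cycle. Qed.

Lemma skew_product_group_set (gT : finGroupType) (s : {perm gT}) :
  skew_morphism s -> group_set (skew_product s).
Proof.
case=> _ [pi s_pi]; rewrite /skew_product.
set L := left_regular_group gT; rewrite -[left_regular gT]/(L : {set _}).
have Ls a : left_mul_perm a * s \in <[s]> * L.
  apply/mulsgP; exists (perm_expz s (pi a)) (left_mul_perm (s a)).
  - exact: perm_expz_cycle.
  - exact: imset_f.
  by apply/permP => x; rewrite !permM !permE s_pi.
have LC k a : left_mul_perm a * s ^+ k \in <[s]> * L.
  elim: k a => [|k IHk] a.
    by rewrite expg0 mulg1 -[left_mul_perm a]mul1g mem_mulg ?group1 // imset_f.
  rewrite expgSr mulgA; have /mulsgP[c _ cC /imsetP[b _ ->] ->] := IHk a.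
  rewrite -mulgA; have /mulsgP[d l dC lL ->] := Ls b.
  by rewrite mulgA mem_mulg ?groupM.
apply/comm_group_setP; apply/eqP; rewrite eqEcard; apply/andP; split.
  by apply/subsetP => _ /mulsgP[_ _ /imsetP[a _ ->] /cycleP[k ->] ->].
by rewrite -card_invg invMg !invGid.
Qed.

Definition skew_product_group (gT : finGroupType) (s : {perm gT})
    (skew_s : skew_morphism s) : {group {perm gT}} :=
  Group (skew_product_group_set skew_s).

Section AffineGroup.
Import GRing.Theory.
Local Open Scope ring_scope.

Definition AGL (n p : nat) : {set {perm 'rV['F_p]_n}} :=
  [set f : {perm 'rV['F_p]_n} |
    [exists A : 'M['F_p]_n, exists b : 'rV['F_p]_n,
      (A \in unitmx) && [forall x, f x == x *m A + b]]].

Lemma AGL_group_set (n p : nat) : group_set (AGL n p).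
Proof.
apply/group_setP; split.
  rewrite inE; apply/existsP; exists 1%:M; apply/existsP; exists 0.
  by rewrite unitmx1; apply/forallP => x; rewrite perm1 mulmx1 addr0.
move=> f g; rewrite !inE.
move=> /existsP[A /existsP[b /andP[uA /forallP fE]]].
move=> /existsP[B /existsP[c /andP[uB /forallP gE]]].
apply/existsP; exists (A *m B); apply/existsP; exists (b *m B + c).
rewrite unitmx_mul uA uB; apply/forallP => x.
by rewrite permM (eqP (gE _)) (eqP (fE _)) mulmxDl mulmxA addrA.
Qed.

Canonical AGL_group (n p : nat) := Group (AGL_group_set n p).

End AffineGroup.

(* Main.v *)
Require Import Defs.
From mathcomp Require Import all_boot all_order all_algebra all_fingroup.
From mathcomp Require Import all_solvable finfield mxabelem.
From mathcomp Require Import boolp ring.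

(* A skew-product group X = G<s> is a product of two abelian groups, so by
   Ito's argument D = [G, <s>] is abelian; its p'-part lies in the core-free
   group <s>, hence is trivial, and the centre of the normal p-subgroup GD is a
   nontrivial normal subgroup N of X contained in G.  Thus s is additive along
   an s-invariant subspace N and induces a skew-morphism on V / N, where
   V = F_p^n.  If that quotient is linear, the elements of <s> trivial on N and
   V / N form a cyclic group of linear maps 1 + u, which forces
   s v = v S + l(v)^2 w for a matrix S, a linear form l and a vector w.  For
   n = 3 and a nonlinear quotient of dimension 2, N can be enlarged to a
   hyperplane.

   For p odd, such a nonlinear s is a skew-morphism exactly when, after a
   unique rescaling of (l, w), one has l(w) = 0, w S = mu w, l(v S) = mu l(v)
   with mu <> 0, 1, and S^(p-1) = 1 + l w.  The map
   v |-> v + l(v)^2 w / (mu - mu^2) then conjugates X into AGL(n, p), and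
   counting the triples (S, l, w) reduces, by transitivity of GL_n on the
   orthogonal pairs (l, w), to counting lower triangular matrices. *)

Set Implicit Arguments.
Unset Strict Implicit.
Unset Printing Implicit Defensive.

(** * Ito's theorem and the core of the regular subgroup *)

Section Ito.
Import GroupScope.
Variable gT : finGroupType.
Implicit Types A B X : {group gT}.

(* For [a, a1] in [A] and [b, b1] in [B], write [a ^ b1 = b2 * a2] and
   [b ^ a1 = a3 * b3]: conjugating [[~ a, b]] by [a1 * b1] or by [b1 * a1]
   gives [[~ a2, b3]] in both cases. *)
Lemma ito_abelian A B : abelian A -> abelian B -> A * B = B * A ->
  abelian [~: A, B].
Proof.
move=> /centsP cAA /centsP cBB AB.
have inAB x y : x \in A * B -> y \in A * B -> x ^ y \in A * B.
  by rewrite -(comm_joingE AB); exact: groupJ.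
have AsAB x : x \in A -> x \in A * B by apply/subsetP/mulG_subl.
have BsAB x : x \in B -> x \in A * B by apply/subsetP/mulG_subr.
have comL (x y z : gT) : commute x z -> [~ x * y, z] = [~ y, z].
  by move=> xz; rewrite commMgJ (eqP (introT commgP xz)) conj1g mul1g.
have comL' (x y z : gT) : commute x y -> [~ x, y * z] = [~ x, z].
  by move=> xz; rewrite commgMJ (eqP (introT commgP xz)) conj1g mulg1.
have key a b a1 b1 : a \in A -> b \in B -> a1 \in A -> b1 \in B ->
    [~ a, b] ^ (a1 * b1) = [~ a, b] ^ (b1 * a1).
  move=> aA bB a1A b1B.
  have /mulsgP[a3 b3 a3A b3B eb] := inAB _ _ (BsAB _ bB) (AsAB _ a1A).
  have : a ^ b1 \in B * A by rewrite -AB; apply: inAB; [apply: AsAB | apply: BsAB].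
  move=> /mulsgP[b2 a2 b2B a2A ea].
  have ja : a ^ a1 = a by apply/conjg_fixP/commgP; exact: cAA.
  have ja2 : a2 ^ a1 = a2 by apply/conjg_fixP/commgP; exact: cAA.
  have jb : b ^ b1 = b by apply/conjg_fixP/commgP; exact: cBB.
  have jb3 : b3 ^ b1 = b3 by apply/conjg_fixP/commgP; exact: cBB.
  transitivity [~ a2, b3].
    rewrite conjgM conjRg ja eb comL'; last exact: cAA.
    by rewrite conjRg jb3 ea comL //; exact: cBB.
  rewrite conjgM conjRg jb ea comL; last exact: cBB.
  by rewrite conjRg ja2 eb comL' //; exact: cAA.
rewrite /abelian /commutator cent_gen gen_subG; apply/subsetP=> _ /imset2P[a b aA bB ->].
rewrite -sub_cent1; apply/subsetP=> _ /imset2P[a1 b1 a1A b1B ->].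
apply/cent1P/commute_sym/commgP/conjg_fixP.
have e : [~ a1, b1] = a1^-1 * b1^-1 * (a1 * b1) by rewrite commgEl conjgE !mulgA.
by rewrite e conjgM key ?groupV // -conjgM mulgA mulgKV mulVg conjg1.
Qed.

Variable p : nat.

(** The subgroup is the centre of [P = A D] with [D = [~: A, B]]. Once the p'-part of [D] is pushed
    into [B], where it must be trivial, [P] is a normal p-group; its nontrivial centre centralises
    [A] and hence lies in [A]. *)
Lemma normal_sub_selfcentral A B X :
    A * B = X -> abelian A -> abelian B -> p.-group A -> A :!=: 1 ->
    'C_X(A) \subset A ->
    (forall K : {group gT}, K \subset B -> K <| X -> K :=: 1) ->
  exists N : {group gT}, [/\ N <| X, N \subset A & N :!=: 1].
Proof.
move=> eX cAA cBB pA ntA sCA corefree.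
have AB : A * B = B * A by apply/comm_group_setP; rewrite eX groupP.
have sAX : A \subset X by rewrite -eX mulG_subl.
have sBX : B \subset X by rewrite -eX mulG_subr.
pose D := [~: A, B]%G.
have nDX : D <| X by have := commg_normal A B; rewrite comm_joingE // eX.
have cDD : abelian D by exact: ito_abelian.
have Q1 : 'O_p^'(D) = 1.
  apply: corefree; last exact: gFnormal_trans.
  set Q := 'O_p^'(D)%G; have nQX : Q <| X by exact: gFnormal_trans.
  have p'Q : p^'.-group Q by exact: pcore_pgroup.
  rewrite -indexg_eq1 -dvdn1.
  have sBN : B \subset 'N(Q) by apply: subset_trans sBX (normal_norm nQX).
  (* After multiplication by the order of [B], the claim is that the order of [Q B] divides that of
     [X] times that of [A :&: B], which holds because [Q B] is a subgroup of [X]. The index is then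
     both a p-number and a p'-number. *)
  have dA : #|Q : B| %| #|A|.
    rewrite -(@dvdn_pmul2r #|B|) // LagrangeMr mul_cardG eX dvdn_mulr //.
    by rewrite -norm_joinEr // cardSg // join_subG (normal_sub nQX).
  have := coprime_dvdl dA (coprime_dvdr (dvdn_indexg Q B) (pnat_coprime pA p'Q)).
  by rewrite /coprime gcdnn => /eqP ->.
have pD : p.-group D.
  have := nilpotent_pcoreC p (abelian_nil cDD).
  by rewrite Q1 dprodg1 => <-; apply: pcore_pgroup.
have nDA : A \subset 'N(D) by apply: subset_trans sAX (normal_norm nDX).
pose P := (A <*> D)%G.
have pP : p.-group P by rewrite /= norm_joinEl // pgroupM pA.
have sPX : P \subset X by rewrite join_subG sAX normal_sub.
have nPX : P <| X.
  rewrite /normal sPX -eX mulG_subG (subset_trans (joing_subl A D)) ?normG //=.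
  apply/subsetP=> b bB; rewrite inE conjYg join_subG; apply/andP; split.
    apply/subsetP=> _ /imsetP[a aA ->]; rewrite conjg_mulR groupM //.
      by rewrite mem_gen // inE aA.
    by apply: (subsetP (joing_subr A D)); rewrite mem_commg.
  rewrite (normP _) ?joing_subr //.
  by apply: (subsetP (normal_norm nDX)); apply: (subsetP sBX).
exists 'Z(P)%G; split; first exact: gFnormal_trans.
  apply: subset_trans sCA; rewrite subsetI (subset_trans (center_sub _)) //=.
  by rewrite (subset_trans (subsetIr _ _)) ?centS ?joing_subl.
rewrite center_nil_eq1 ?(pgroup_nil pP) //; apply: contraNneq ntA => P1.
by rewrite -subG1 -P1 joing_subl.
Qed.

End Ito.

(** * Groups of translations normalised by a skew-morphism *)

Section SkewCore.
Import GroupScope.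
Variable gT : finGroupType.

Lemma left_mul_permE (g h : gT) : left_mul_perm g h = g * h.
Proof. by rewrite permE. Qed.

Lemma left_mul_permM (g h : gT) :
  left_mul_perm g * left_mul_perm h = left_mul_perm (h * g).
Proof. by apply/permP=> x; rewrite permM !left_mul_permE mulgA. Qed.

Lemma cycle_fix (T : finType) (s x : {perm T}) (a : T) :
  s a = a -> x \in <[s]> -> x a = a.
Proof.
move=> sa /cycleP[k ->]; elim: k => [|k IH]; first by rewrite expg0 perm1.
by rewrite expgSr permM IH.
Qed.

(** [normal_sub_selfcentral] yields a normal subgroup of the skew-product group that consists of
    left multiplications. Since [s] normalises it, conjugation by [s] turns multiplication by [n]
    into multiplication by [s n], which is the required identity. *)
Lemma skew_preserved_subgroup (p : nat) (s : {perm gT}) :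
    p.-group [set: gT] -> abelian [set: gT] -> [set: gT] != 1 ->
    skew_morphism s ->
  exists N : {group gT}, N :!=: 1 /\
    forall n, n \in N -> s n \in N /\ forall h, s (n * h) = s n * s h.
Proof.
move=> pG /centsP cGG ntG skew_s; have s1 := proj1 skew_s.
have cLL : abelian (left_regular_group gT).
  apply/centsP=> _ /imsetP[a _ ->] _ /imsetP[b _ ->].
  by rewrite /commute !left_mul_permM cGG ?inE.
have injL : injective (@left_mul_perm gT).
  by move=> a b /permP/(_ 1); rewrite !left_mul_permE !mulg1.
have cardL : #|left_regular_group gT| = #|gT| by rewrite card_imset // cardsT.
have nL1 : left_mul_perm (1 : gT) = 1.
  by apply/permP=> x; rewrite left_mul_permE mul1g perm1.
have := @normal_sub_selfcentral _ p (left_regular_group gT) <[s]>%G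
   (skew_product_group skew_s) erefl cLL (cycle_abelian s).
case.
- by rewrite /pgroup cardL -cardsT.
- apply: contra ntG => /eqP L1; rewrite trivg_card1 cardsT -cardL; apply/eqP.
  by rewrite L1 cards1.
(* A permutation centralising the regular abelian group is multiplication by its own value at 1. *)
- apply/subsetP=> x /setIP[_ /centP cx]; apply/imsetP; exists (x 1) => //.
  apply/permP=> a; rewrite left_mul_permE.
  have /permP/(_ 1) := cx (left_mul_perm a) (imset_f (@left_mul_perm gT) (isT : a \in gT)).
  by rewrite !permM !left_mul_permE mulg1 => <-; apply: cGG; rewrite inE.
(* [K] fixes 1 and is normalised by a transitive group, so it fixes every point. *)
- move=> K sKs nKX; apply/trivgP/subsetP=> k kK; rewrite inE; apply/eqP/permP=> a.
  have aX : left_mul_perm a \in skew_product_group skew_s.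
    by apply: (subsetP (mulG_subl _ _)); apply: imset_f.
  have : k ^ (left_mul_perm a)^-1 \in K by rewrite memJ_norm // groupV (subsetP (normal_norm nKX)).
  move=> /(subsetP sKs)/(cycle_fix s1); rewrite conjgE invgK !permM left_mul_permE mulg1 perm1.
  by move/(congr1 (left_mul_perm a)); rewrite permKV left_mul_permE mulg1.
move=> M [nMX sML ntM].
have gN : group_set [set g | left_mul_perm g \in M].
  apply/group_setP; split=> [|a b]; first by rewrite inE nL1.
  by rewrite !inE => aM bM; rewrite -left_mul_permM groupM.
exists (Group gN); split.
  apply: contra ntM => /eqP/= N1; apply/eqP/trivgP/subsetP=> x xM.
  have /imsetP[a _ xa] := subsetP sML _ xM.
  have : a \in [set g | left_mul_perm g \in M] by rewrite inE -xa.
  by rewrite N1 inE => /eqP a1; rewrite xa a1 nL1 inE.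
move=> n /=; rewrite inE => nM.
have sX : s \in skew_product_group skew_s.
  by apply: (subsetP (mulG_subr _ _)); apply: cycle_id.
have := nM; rewrite -(memJ_norm _ (subsetP (normal_norm nMX) _ sX)) => nsM.
have /imsetP[n' _ en] := subsetP sML _ nsM.
have E h : s (n * h) = n' * s h.
  have /permP/(_ (s h)) := en.
  by rewrite conjgE !permM permK !left_mul_permE.
have en' : n' = s n by rewrite -(mulg1 n) E s1 mulg1.
by rewrite -en' inE -en; split.
Qed.

End SkewCore.

Import GRing.Theory.
Local Open Scope ring_scope.

(** * Skew-morphisms of vector spaces *)

Section VectorSpaces.
Variable p : nat.
Hypothesis p_prime : prime p.
Local Notation F := 'F_p.

Lemma natr_p0 : p%:R = 0 :> F.
Proof. by apply/eqP; have := pchar_Fp p_prime => /andP[]. Qed.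

Lemma two_neq0 : p <> 2%N -> 2%:R != 0 :> F.
Proof.
move=> p2; rewrite -(dvdn_pcharf (pchar_Fp p_prime)); apply/negP => /prime_nt_dvdP e.
by apply: p2; apply: e => //; case: p p_prime => [|[]].
Qed.

Lemma Fp_expp (x : F) : x ^+ p = x.
Proof. by have := expf_card x; rewrite card_Fp. Qed.

Lemma scaleE (V : lmodType F) (a : F) (v : V) : a *: v = v *+ a.
Proof. by rewrite -[in LHS](natr_Zp a) scaler_nat. Qed.

Lemma mulrnp (V : lmodType F) (v : V) : v *+ p = 0.
Proof. by rewrite -scaler_nat natr_p0 scale0r. Qed.

Lemma additive_mulmx n m (f : 'rV[F]_n -> 'rV[F]_m) :
  {morph f : x y / x + y} -> exists S, forall v, f v = v *m S.
Proof.
move=> fD; have f0 : f 0 = 0.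
  by apply: (@addrI _ (f 0)); rewrite -fD !addr0.
have fM k v : f (v *+ k) = f v *+ k.
  by elim: k => [|k IH]; rewrite ?mulr0n // !mulrS fD IH.
have fZ a v : f (a *: v) = a *: f v by rewrite !scaleE fM.
exists (\matrix_i f (delta_mx 0 i)) => v.
rewrite [v in LHS]row_sum_delta mulmx_sum_row.
rewrite (big_morph f fD f0); apply: eq_bigr => i _.
by rewrite fZ rowK.
Qed.

Definition sc n (v : 'rV[F]_n) (l : 'cV[F]_n) : F := (v *m l) 0 0.

Lemma scD n v w (l : 'cV_n) : sc (v + w) l = sc v l + sc w l.
Proof. by rewrite /sc mulmxDl mxE. Qed.
Lemma scZ n a v (l : 'cV_n) : sc (a *: v) l = a * sc v l.
Proof. by rewrite /sc -scalemxAl mxE. Qed.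
Lemma scZr n a (v : 'rV[F]_n) (l : 'cV_n) : sc v (a *: l) = a * sc v l.
Proof. by rewrite /sc -scalemxAr [LHS]mxE. Qed.
Lemma scN n v (l : 'cV_n) : sc (- v) l = - sc v l.
Proof. by rewrite /sc mulNmx mxE. Qed.
Lemma sc0 n (l : 'cV_n) : sc 0 l = 0.
Proof. by rewrite /sc mul0mx mxE. Qed.
Lemma scM n m v (S : 'M_(n, m)) l : sc (v *m S) l = sc v (S *m l).
Proof. by rewrite /sc mulmxA. Qed.
Lemma scE n v (l : 'cV_n) : v *m l = (sc v l)%:M.
Proof. by rewrite [LHS]mx11_scalar. Qed.
Lemma mul_outer n m v (l : 'cV_n) (w : 'rV_m) : v *m (l *m w) = sc v l *: w.
Proof. by rewrite mulmxA scE mul_scalar_mx. Qed.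

Lemma sc_neq0 n (l : 'cV[F]_n) : l != 0 -> exists v, sc v l != 0.
Proof.
move=> l0; case: (pickP (fun i => l i 0 != 0)) => [i li|l00].
  exists (delta_mx 0 i); rewrite /sc mxE (bigD1 i) //= big1 ?addr0 ?mxE ?eqxx ?mul1r //.
  by move=> j ji; rewrite mxE (negPf ji) andbF mul0r.
case/eqP: l0; apply/matrixP => i j; rewrite ord1 mxE.
by apply/eqP; have := l00 i => /= /negbFE.
Qed.

Lemma sc_inj n (l l' : 'cV[F]_n) : (forall v, sc v l = sc v l') -> l = l'.
Proof.
move=> E; apply/eqP; rewrite -subr_eq0; apply/negPn/negP => /sc_neq0[v].
by rewrite /sc mulmxBr mxE [X in _ + X]mxE -!/(sc _ _) E subrr eqxx.
Qed.

(** Natural exponents replace the integer ones of [skew_morphism]; nothing is lost because the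
    cyclic group of [s] is finite. *)
Definition askew n (s : {perm 'rV[F]_n}) : Prop :=
  s 0 = 0 /\
  forall g, exists k, forall h, s (g + h) = s g + (s ^+ k)%g h.

Lemma askewP n (s : {perm 'rV[F]_n}) : skew_morphism s <-> askew s.
Proof.
split=> [[s0 [pi E]]|[s0 E]]; split=> //.
  move=> g; have /cycleP[k ek] := perm_expz_cycle s (pi g).
  by exists k => h; rewrite -ek; exact: E.
have [f fE] := choice E; exists (fun g => Posz (f g)) => g h; exact: fE.
Qed.

(** A power of a skew-morphism obeys a weaker law: the twisting permutation [y] is a power of [s],
    not necessarily of [x]. *)
Lemma askew_cycle n (s x : {perm 'rV[F]_n}) : askew s -> x \in <[s]>%g ->
  forall g, exists2 y, y \in <[s]>%g & forall h, x (g + h) = x g + y h.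
Proof.
move=> [s0 sE] /cycleP[k ->] g; elim: k => [|k [y yC IH]].
  by exists 1%g => [|h]; rewrite ?group1 // expg0 !perm1.
have [j jE] := sE ((s ^+ k)%g g).
exists (y * s ^+ j)%g; first by rewrite groupM // mem_cycle.
by move=> h; rewrite expgSr !permM IH jE.
Qed.

Lemma askew_cycle0 n (s x : {perm 'rV[F]_n}) : askew s -> x \in <[s]>%g ->
  x 0 = 0.
Proof. by move=> [s0 _]; exact: cycle_fix. Qed.

(** Over a prime field scalars act as integer multiples, so a subgroup is a subspace. Presenting it
    as the kernel of a surjection [Q] with section [R] gives the quotient the concrete form of a row
    space. *)
Lemma subgroup_ker n (N : {group 'rV[F]_n}) : (N :!=: 1)%g ->
  exists m (Q : 'M[F]_(n, m)) (R : 'M[F]_(m, n)),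
    [/\ (m < n)%N, R *m Q = 1%:M & forall v, v \in N <-> v *m Q = 0].
Proof.
move=> ntN; pose A := (\sum_(v in N) <<v>>)%MS.
have NA v : v \in N <-> (v <= A)%MS.
  split=> [vN|]; first by apply: (sumsmx_sup v); rewrite // genmxE.
  move=> /sub_sumsmxP[u_ ->]; elim/big_rec: _ => [|w x wN xN]; first exact: group1 N.
  apply: (@groupM _ N) => //.
  have /sub_rVP[a ->] : (u_ w *m <<w>> <= w)%MS by rewrite mulmx_sub // genmxE.
  by rewrite scaleE; exact: (@groupX _ N).
pose C := cokermx A.
have /row_fullP[R RQ] := col_base_full C.
have QE v : v *m col_base C = 0 <-> v *m C = 0.
  split=> [e|]; first by rewrite -[C]mulmx_base mulmxA e mul0mx.
  rewrite -{1}[C]mulmx_base mulmxA => /(congr1 (mulmxr (pinvmx (row_base C)))).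
  by rewrite /= mulmxKp ?row_base_free // mul0mx.
exists (\rank C), (col_base C), R; split=> // [|v].
  rewrite mxrank_coker -subSn ?rank_leq_col // leq_subLR -addn1 addnC leq_add2r.
  rewrite lt0n mxrank_eq0; apply: contraNneq ntN => A0.
  apply/eqP/trivgP/subsetP=> v /NA; rewrite A0 submx0 => /eqP ->; exact: set11.
by rewrite QE NA; split=> [|/eqP]; rewrite submxE => // /eqP.
Qed.

(** Equivalently, [s] fixes 0 and normalises the group of translations by the subspace ker Q. *)
Definition preserved n m (s : {perm 'rV[F]_n}) (Q : 'M[F]_(n, m)) : Prop :=
  forall a, a *m Q = 0 -> s a *m Q = 0 /\ forall h, s (a + h) = s a + s h.

Lemma preserved_cycle n m (s x : {perm 'rV[F]_n}) (Q : 'M_(n, m)) :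
  preserved s Q -> x \in <[s]>%g -> preserved x Q.
Proof.
move=> sQ /cycleP[k ->] a aQ; elim: k => [|k [IH IH']].
  by rewrite expg0 perm1; split=> // h; rewrite !perm1.
rewrite expgSr permM; have [aQ' aD] := sQ _ IH; split=> // h.
by rewrite !permM IH' aD.
Qed.

(** Additivity along ker Q makes [s v *m Q] depend on [v *m Q] only; [R] supplies the
    representatives. *)
Lemma skew_quotient n m (s : {perm 'rV[F]_n}) (Q : 'M_(n, m)) R :
    askew s -> preserved s Q -> R *m Q = 1%:M ->
  exists2 t : {perm 'rV[F]_m}, askew t &
    forall k v, (t ^+ k)%g (v *m Q) = (s ^+ k)%g v *m Q.
Proof.
move=> [s0 sE] sQ RQ; pose f y := s (y *m R) *m Q.
have fE v : f (v *m Q) = s v *m Q.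
  have aQ : (v - v *m Q *m R) *m Q = 0.
    by rewrite mulmxBl -!mulmxA RQ mulmx1 subrr.
  have [sa sD] := sQ _ aQ.
  by rewrite -[in RHS](subrK (v *m Q *m R) v) sD mulmxDl sa add0r.
pose g y := (s^-1)%g (y *m R) *m Q.
have gK : cancel g f by move=> y; rewrite fE permKV -mulmxA RQ mulmx1.
pose t := perm (can_inj (canF_sym gK)).
have tE k v : (t ^+ k)%g (v *m Q) = (s ^+ k)%g v *m Q.
  elim: k => [|k IH]; first by rewrite !expg0 !perm1.
  by rewrite !expgSr !permM IH permE fE.
exists t => //; split=> [|y]; first by rewrite permE /f mul0mx s0 mul0mx.
have [k kE] := sE (y *m R); exists k => z.
have /= t1 := tE 1%N; rewrite !expg1 in t1.
have yE : y = y *m R *m Q by rewrite -mulmxA RQ mulmx1.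
have zE : z = z *m R *m Q by rewrite -mulmxA RQ mulmx1.
by rewrite {1}yE {1}zE -mulmxDl t1 kE mulmxDl [in RHS]zE tE [in t y]yE t1.
Qed.

(* By the symmetry of [b + h], either [j = 1] throughout or [u] takes values in a
   line; in the latter case [j] is a homomorphism to the group of units of
   [F_p], hence trivial. *)
Lemma skew_affine_additive n m (u : 'rV[F]_n -> 'rV[F]_m) : u 0 = 0 ->
    (forall b, exists j : F, forall h, u (b + h) = u b + j *: u h) ->
  {morph u : x y / x + y}.
Proof.
move=> u0 /choice[j jE].
case: (pickP (fun h => u h != 0)) => [h0 h00|u00]; last first.
  by move=> x y; have U z := eqP (negbFE (u00 z)); rewrite !U addr0.
have sym b : (j b - 1) *: u h0 = (j h0 - 1) *: u b.
  rewrite !scalerBl !scale1r; apply/eqP.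
  rewrite -(inj_eq (addrI (u b + u h0))) addrACA subrr addr0.
  by rewrite [X in _ == X + _]addrC addrACA subrr addr0 -!jE addrC.
have [jh0|jh0] := eqVneq (j h0) 1.
  move=> x y; rewrite jE; have := sym x; rewrite jh0 subrr scale0r => /eqP.
  by rewrite scaler_eq0 (negPf h00) orbF subr_eq0 => /eqP ->; rewrite scale1r.
have j0 : j h0 - 1 != 0 by rewrite subr_eq0.
have [c c0 uE] : exists2 c, c != 0 & forall b, u b = (j b - 1) *: c.
  exists ((j h0 - 1)^-1 *: u h0); first by rewrite scaler_eq0 invr_eq0 negb_or j0.
  by move=> b; rewrite scalerA mulrC -scalerA sym scalerA mulVf // scale1r.
have jM x y : j (x + y) = j x * j y.
  have := jE x y; rewrite !uE scalerA -scalerDl => /eqP.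
  rewrite -subr_eq0 -scalerBl scaler_eq0 (negPf c0) orbF subr_eq0 => /eqP e.
  by apply: (addIr (-1)); rewrite e; ring.
have j00 : j 0 = 1.
  have := uE 0; rewrite u0 => /esym/eqP.
  by rewrite scaler_eq0 (negPf c0) orbF subr_eq0 => /eqP.
have jX k : j (h0 *+ k) = j h0 ^+ k.
  by elim: k => [|k IH]; rewrite ?mulr0n // mulrS jM IH exprS.
(* By Fermat, [j h0 = j h0 ^+ p = j (h0 *+ p) = j 0 = 1]. *)
by case/eqP: jh0; rewrite -[j h0]Fp_expp -jX mulrnp.
Qed.

End VectorSpaces.

(** * Powers of [s] that act trivially on a subspace and on its quotient *)

Section TrivialOnQuotient.
Variable p : nat.
Hypothesis p_prime : prime p.
Local Notation F := 'F_p.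

Section KerCycle.
Variables (n m : nat) (s : {perm 'rV[F]_n}) (Q : 'M[F]_(n, m)).

(* [Q] presents the subspace [N = ker Q]; these are the elements of [<[s]>]
   acting trivially on both [N] and [V / N]. *)
Definition ker_cycle : {set {perm 'rV[F]_n}} :=
  [set x in <[s]>%g | [forall a, (a *m Q == 0) ==> (x a == a)]
                      && [forall h, x h *m Q == h *m Q]].

Lemma ker_cycleP x : reflect
  [/\ x \in <[s]>%g, forall a, a *m Q = 0 -> x a = a
    & forall h, x h *m Q = h *m Q] (x \in ker_cycle).
Proof.
rewrite inE; apply: (iffP andP) => [[xs /andP[/forallP xa /forallP xh]]|[xs xa xh]].
  split=> // [a aQ|h]; last exact/eqP.
  by have := xa a; rewrite aQ eqxx => /eqP.
split=> //; apply/andP; split; apply/forallP=> a; last by rewrite xh.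
by apply/implyP=> /eqP/xa->.
Qed.

Lemma ker_cycle_generator : exists t, (<[t]> = ker_cycle)%g.
Proof.
have gK : group_set ker_cycle.
  apply/group_setP; split.
    by apply/ker_cycleP; split=> [|a _|h]; rewrite ?group1 ?perm1.
  move=> x y /ker_cycleP[xs xa xh] /ker_cycleP[ys ya yh]; apply/ker_cycleP.
  split=> [|a aQ|h]; first exact: groupM.
    by rewrite permM xa // ya.
  by rewrite permM yh xh.
have : cyclic (Group gK).
  apply: cyclicS (cycle_cyclic s).
  by apply/subsetP=> x /ker_cycleP[].
by case/cyclicP=> t tE; exists t; rewrite -tE.
Qed.

Hypothesis skew_s : askew s.
Hypothesis sQ : preserved s Q.

(** The displacement [t h - h] lies in ker Q, which [t] fixes pointwise and along which it is
    additive, so each iteration adds the same displacement. *)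
Lemma ker_cycle_expg t k h : t \in ker_cycle ->
  (t ^+ k)%g h = h + (t h - h) *+ k.
Proof.
case/ker_cycleP=> ts ta th; elim: k => [|k IH].
  by rewrite expg0 perm1 mulr0n addr0.
have aQ : ((t h - h) *+ k) *m Q = 0.
  by rewrite -scaler_nat -scalemxAl mulmxBl th subrr scaler0.
have [_ tD] := preserved_cycle sQ ts aQ.
by rewrite expgSr permM IH addrC tD ta // mulrSr addrCA [h + _]addrC subrK.
Qed.

(** The twisting permutation of [t] again lies in [ker_cycle], hence is a power of the generator
    [t]. By [ker_cycle_expg] its displacement is a multiple of that of [t], so
    [skew_affine_additive] applies. *)
Lemma ker_cycle_additive t : (<[t]> = ker_cycle)%g ->
  {morph (fun h => t h - h) : x y / x + y}.
Proof.
move=> tE; have tK : t \in ker_cycle by rewrite -tE cycle_id.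
have [ts ta th] := ker_cycleP _ tK.
apply: skew_affine_additive; rewrite ?(askew_cycle0 skew_s) ?subr0 // => b.
have [y ys yE] := askew_cycle skew_s ts b.
have : y \in ker_cycle.
  apply/ker_cycleP; split=> // [a aQ|h].
    apply: (@addrI _ (t b)); rewrite -yE addrC.
    by have [_ ->] := preserved_cycle sQ ts aQ; rewrite ta // addrC.
  have -> : y h = t (b + h) - t b by rewrite yE addrC addKr.
  by rewrite mulmxBl !th mulmxDl addrC addKr.
rewrite -tE => /cycleP[k ek]; exists k%:R => h.
rewrite yE ek ker_cycle_expg // scaler_nat opprD addrACA.
by rewrite [h + _]addrC -[_ - h]addrA subrr addr0.
Qed.

(** The tool for lifting additivity from the quotient: if [x] is additive at [b] modulo ker Q, its
    twist differs from [x] only by an element of [ker_cycle]. *)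
Lemma cycle_defect x b : x \in <[s]>%g ->
    (forall h, (x (b + h) - x b - x h) *m Q = 0) ->
  exists2 z, z \in ker_cycle & forall h, x (b + h) = x b + z (x h).
Proof.
move=> xs xD; have [y ys yE] := askew_cycle skew_s xs b.
exists (x^-1 * y)%g; last by move=> h; rewrite permM permK yE.
have xVs : (x^-1)%g \in <[s]>%g by rewrite groupV.
apply/ker_cycleP; split=> [|a aQ|h]; first exact: groupM.
  have [aQ' _] := preserved_cycle sQ xVs aQ.
  apply: (@addrI _ (x b)); rewrite permM -yE addrC.
  by have [_ ->] := preserved_cycle sQ xs aQ'; rewrite permKV addrC.
rewrite permM; apply/eqP; rewrite -subr_eq0 -mulmxBl; apply/eqP.
rewrite -[RHS](xD ((x^-1)%g h)) yE permKV.
by congr (_ *m _); congr (_ - _); rewrite addrC addKr.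
Qed.

(** With [t] generating [ker_cycle] and [q h = t (s h) - s h], the defect of additivity of [s] is
    [j b *: q h]. Its symmetry in [b] and [h] makes it vanish or take the form [(j b * j h) *: c]
    with [j] linear, the polarisation of a quadratic term. *)
Lemma quadratic_of_quotient_additive :
    (forall b h, (s (b + h) - s b - s h) *m Q = 0) ->
  (exists S, forall v, s v = v *m S) \/
  (p <> 2%N /\ exists S l w, [/\ l != 0, w != 0
     & forall v, s v = v *m S + sc v l ^+ 2 *: w]).
Proof.
move=> sD; have [t tE] := ker_cycle_generator.
have tK : t \in ker_cycle by rewrite -tE cycle_id.
have [ts ta th] := ker_cycleP _ tK.
have uD := ker_cycle_additive tE.
pose q h := t (s h) - s h.
have ss : s \in <[s]>%g by exact: cycle_id.
(* The additivity defect of [s] lies in ker Q, where [t] is the identity, so passing to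
   displacements of [t] removes it. *)
have qD : {morph q : x y / x + y}.
  move=> x y; have : s (x + y) = s x + s y + (s (x + y) - s x - s y).
    by rewrite -[X in _ = _ + X]addrA -opprD [RHS]addrC subrK.
  move=> e; rewrite /q e uD uD; set z := s (x + y) - _ - _.
  by rewrite (ta z) ?sD // subrr addr0.
have /choice[j jE] : forall b, exists j : F, forall h,
    s (b + h) = s b + s h + j *: q h.
  move=> b; have [z] := cycle_defect ss (sD b).
  rewrite -tE => /cycleP[k ->] zE; exists k%:R => h.
  by rewrite zE ker_cycle_expg // scaler_nat addrA.
have additive_case : {morph s : x y / x + y} -> exists S, forall v, s v = v *m S.
  exact: additive_mulmx.
case: (pickP (fun h => q h != 0)) => [h0 h00|q0]; last first.
  left; apply: additive_case => x y; rewrite jE.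
  by rewrite (eqP (negbFE (q0 y))) scaler0 addr0.
have sym b : j b *: q h0 = j h0 *: q b.
  apply: (@addrI _ (s b + s h0)); rewrite -jE [b + _]addrC.
  by rewrite jE [s b + _]addrC.
have [jh0|jh0] := eqVneq (j h0) 0.
  left; apply: additive_case => x y; rewrite jE.
  have := sym x; rewrite jh0 scale0r => /eqP.
  by rewrite scaler_eq0 (negPf h00) orbF => /eqP ->; rewrite scale0r addr0.
have [c c0 qE] : exists2 c, c != 0 & forall b, q b = j b *: c.
  exists ((j h0)^-1 *: q h0); first by rewrite scaler_eq0 invr_eq0 negb_or jh0.
  by move=> b; rewrite scalerA mulrC -scalerA sym scalerA mulVf // scale1r.
have jD x y : j (x + y) = j x + j y.
  have /eqP := qD x y; rewrite !qE -scalerDl -subr_eq0 -scalerBl scaler_eq0.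
  by rewrite (negPf c0) orbF subr_eq0 => /eqP.
have sE x y : s (x + y) = s x + s y + (j x * j y) *: c by rewrite jE qE scalerA.
(* In characteristic 2, [s (h0 + h0) = s 0 = 0] would force [(j h0 * j h0) *: c = 0]. *)
have p2 : p <> 2%N.
  move=> p2; have V2 (v : 'rV[F]_n) : v + v = 0.
    by rewrite -(mulrnp p_prime v) -mulr2n; congr (_ *+ _); exact/esym.
  have := sE h0 h0; rewrite !V2 (askew_cycle0 skew_s ss) add0r => /esym/eqP.
  by rewrite scaler_eq0 (negPf c0) mulf_eq0 (negPf jh0).
right; split=> //.
have two0 := two_neq0 p_prime p2.
have [l lE] : exists l, forall v, sc v l = j v.
  have [|l lE] := @additive_mulmx p n 1 (fun v => (j v)%:M).
  - by move=> x y; rewrite jD raddfD.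
  by exists l => v; rewrite /sc -lE mxE.
(* Subtracting half of the diagonal of the bilinear defect leaves an additive map. *)
have [|S SE] := @additive_mulmx p n n (fun v => s v - (j v ^+ 2 / 2%:R) *: c).
  move=> x y /=; rewrite sE jD.
  have -> : (j x + j y) ^+ 2 / 2%:R = j x ^+ 2 / 2%:R + j y ^+ 2 / 2%:R + j x * j y.
    by field.
  by rewrite !scalerDl opprD addrACA subrr addr0 opprD addrACA.
exists S, l, (2%:R^-1 *: c); split.
- by apply: contraNneq jh0 => l0; rewrite -lE l0 /sc mulmx0 mxE.
- by rewrite scaler_eq0 invr_eq0 negb_or two0.
- by move=> v; rewrite -SE lE scalerA subrK.
Qed.

End KerCycle.
End TrivialOnQuotient.

(** * Quadratic skew-morphisms *)

Section QuadraticSkew.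
Variable p : nat.
Hypothesis p_prime : prime p.
Local Notation F := 'F_p.

Lemma skew_preserved n (s : {perm 'rV[F]_n}) : (0 < n)%N -> askew s ->
  exists m (Q : 'M[F]_(n, m)) (R : 'M[F]_(m, n)),
    [/\ (m < n)%N, R *m Q = 1%:M & preserved s Q].
Proof.
move=> n0 /askewP skew_s.
have cardV : #|[set: 'rV[F]_n]| = (p ^ n)%N.
  by rewrite cardsT card_mx card_Fp // mul1n.
have [|||N [ntN NE]] := skew_preserved_subgroup (p := p) _ _ _ skew_s.
- by rewrite /pgroup cardV pnatX pnat_id.
- exact: FinRing.zmod_abelian.
- rewrite -cardG_gt1 cardV -(expn0 p) ltn_exp2l ?prime_gt1 //.
have [m [Q [R [mn RQ QE]]]] := subgroup_ker ntN.
exists m, Q, R; split=> // a /QE/NE[saN aD]; split=> //; exact/QE.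
Qed.

(** In dimension one the nonzero preserved subspace is the whole space. *)
Lemma skew_linear1 (s : {perm 'rV[F]_1}) : askew s ->
  exists S, forall v, s v = v *m S.
Proof.
move=> /(skew_preserved (ltn0Sn 0))[[|m] [Q [R [// _ _ sQ]]]].
by apply: additive_mulmx => x y; have [|_ ->] := sQ x; rewrite ?thinmx0.
Qed.

Lemma mulmx_ext n m (A B : 'M[F]_(n, m)) :
  (forall v : 'rV_n, v *m A = v *m B) -> A = B.
Proof. by move=> E; apply/row_matrixP=> i; rewrite !rowE E. Qed.

(* Coefficient of [l(v)^2 w] in the [k]-th iterate of [v |-> v S + l(v)^2 w]. *)
Fixpoint qcoef (mu : F) k : F :=
  if k is k'.+1 then qcoef mu k' * mu + mu ^+ k' ^+ 2 else 0.

Lemma mulmx_eigen n (S : 'M[F]_n) (w : 'rV_n) mu k :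
  w *m S = mu *: w -> w *m S ^+ k = mu ^+ k *: w.
Proof.
move=> wS; elim: k => [|k IH]; first by rewrite !expr0 mulmx1 scale1r.
by rewrite exprSr mulmxA IH -scalemxAl wS scalerA exprSr.
Qed.

Lemma mulmx_eigen_col n (S : 'M[F]_n) (l : 'cV_n) mu k :
  S *m l = mu *: l -> S ^+ k *m l = mu ^+ k *: l.
Proof.
move=> Sl; elim: k => [|k IH]; first by rewrite !expr0 mul1mx scale1r.
by rewrite exprS -mulmxA IH -scalemxAr Sl scalerA exprSr.
Qed.

Lemma quadratic_expg n (s : {perm 'rV[F]_n}) (S : 'M_n) l w mu :
    (forall v, s v = v *m S + sc v l ^+ 2 *: w) ->
    sc w l = 0 -> w *m S = mu *: w -> S *m l = mu *: l ->
  forall k v, (s ^+ k)%g v = v *m S ^+ k + (qcoef mu k * sc v l ^+ 2) *: w.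
Proof.
move=> sE wl wS Sl k v; elim: k => [|k IH].
  by rewrite expg0 perm1 expr0 mulmx1 mul0r scale0r addr0.
rewrite expgSr permM sE IH mulmxDl -mulmxA -[S ^+ k *m S]/(S ^+ k * S) -exprSr.
rewrite -scalemxAl wS.
rewrite scD scZ wl mulr0 addr0 scM (mulmx_eigen_col k Sl).
by rewrite scZr -addrA scalerA -scalerDl; congr (_ + _ *: _) => /=; ring.
Qed.

(** Skewness says that each map [h |-> s h + t l(h) w] is a power of [s]. Commutation of these
    powers with [s] gives the eigenvector relations; comparing the case [t = 1] with the explicit
    iterates of [s] gives the conditions on [S ^+ k] and [qcoef]. *)
Lemma skew_quadratic n (s : {perm 'rV[F]_n}) S l w :
    p <> 2%N -> askew s -> l != 0 -> w != 0 ->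
    (forall v, s v = v *m S + sc v l ^+ 2 *: w) ->
  sc w l = 0 /\ exists mu k,
    [/\ mu != 0, w *m S = mu *: w, S *m l = mu *: l,
        S ^+ k = 1 + mu^-1 *: (l *m w) & qcoef mu k.+1 = 1].
Proof.
move=> p2 [s0 skE] l0 w0 sE; have nz2 := two_neq0 p_prime p2.
have [v0 lv0] := sc_neq0 l0.
have [i wi] : exists i, w 0 i != 0.
  apply/existsP; apply: contraNT w0; rewrite negb_exists => /forallP w0.
  by apply/eqP/rowP=> i; rewrite mxE; apply/eqP; have := w0 i; rewrite negbK.
(* The base point is scaled so that [l] takes the value [t / 2] on it; the cross term of the square
   is then [t l(h) w]. *)
have skt t : exists k, forall h, (s ^+ k)%g h = s h + (t * sc h l) *: w.
  have [k kE] := skE ((t / 2%:R / sc v0 l) *: v0); exists k => h.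
  apply: (@addrI _ (s ((t / 2%:R / sc v0 l) *: v0))); rewrite -kE !sE.
  rewrite mulmxDl scD scZ divfK // -!addrA; congr (_ + _).
  rewrite [RHS]addrCA; congr (_ + _); rewrite -!scalerDl; congr (_ *: _).
  by field.
(* Coordinate [j] of the commutation of [s] with its power from [skt]. *)
have comm t h j : t * sc h l * (w *m S) 0 j + (sc (s h) l + t * sc h l * sc w l) ^+ 2 * w 0 j
   = sc (s h) l ^+ 2 * w 0 j + t * sc (s h) l * w 0 j.
  have [k kE] := skt t.
  have : s ((s ^+ k)%g h) = (s ^+ k)%g (s h) by rewrite -!permM -expgS -expgSr.
  rewrite !kE sE mulmxDl scD scZ -scalemxAl [in s (s h)]sE -!addrA.
  by move/addrI/rowP/(_ j); rewrite !mxE.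
(* Adding the relations for [t = 1] and [t = -1] leaves twice the square of [l(v0) l(w)]. *)
have wl : sc w l = 0.
  have e1 := comm 1 v0 i; have e2 := comm (-1) v0 i.
  have : 2%:R * (sc v0 l * sc w l) ^+ 2 * w 0 i = 0.
    apply/eqP; rewrite -(inj_eq (addrI (sc (s v0) l ^+ 2 * w 0 i + 1 * sc (s v0) l * w 0 i +
       (sc (s v0) l ^+ 2 * w 0 i + (-1) * sc (s v0) l * w 0 i)))) addr0 -{2}e1 -{2}e2.
    by apply/eqP; ring.
  by move/eqP; rewrite !mulf_eq0 (negPf wi) (negPf nz2) (negPf lv0) /= orbF orbb => /eqP.
have lsE h : sc (s h) l = sc (h *m S) l by rewrite sE scD scZ wl mulr0 addr0.
have wSE h j : sc h l * (w *m S) 0 j = sc (h *m S) l * w 0 j.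
  have := comm 1 h j; rewrite wl mulr0 addr0 !mul1r addrC lsE => /addrI.
  by [].
pose mu := sc (v0 *m S) l / sc v0 l.
have wS : w *m S = mu *: w.
  apply/rowP=> j; rewrite [RHS]mxE; apply: (mulfI lv0); rewrite wSE /mu.
  by field.
have lS h : sc (h *m S) l = mu * sc h l.
  apply: (mulIf wi); rewrite -wSE wS mxE; ring.
have Sl : S *m l = mu *: l.
  by apply: sc_inj => v; rewrite -scM lS scZr.
have mu0 : mu != 0.
  apply: contraNneq w0 => m0; apply/eqP/(@perm_inj _ s).
  by rewrite s0 sE wl wS m0 expr0n !scale0r addr0.
have Su : S \in unitmx.
  rewrite -row_free_unit -kermx_eq0; apply/eqP/row_matrixP=> j; rewrite row0.
  have e : row j (kermx S) *m S = 0 by rewrite -row_mul mulmx_ker row0.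
  apply: (@perm_inj _ s); rewrite s0 sE e add0r.
  have := lS (row j (kermx S)); rewrite e sc0 => /esym/eqP.
  by rewrite mulf_eq0 (negPf mu0) => /eqP ->; rewrite expr0n scale0r.
have [k kE] := skt 1; have pE := quadratic_expg sE wl wS Sl.
have e1 h : h *m S ^+ k + (qcoef mu k * sc h l ^+ 2) *: w =
   h *m S + sc h l ^+ 2 *: w + sc h l *: w.
  by rewrite -pE kE mul1r sE.
(* The part of [e1] that is even in [h], isolated by adding its values at [v0] and [- v0]. *)
have q1 : qcoef mu k = 1.
  have /rowP/(_ i) := e1 v0; have /rowP/(_ i) := e1 (- v0).
  rewrite !mulNmx scN; move: (v0 *m S ^+ k) (v0 *m S) => a b.
  rewrite !mxE => ea eb; apply/eqP; rewrite -subr_eq0.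
  have : 2%:R * (qcoef mu k - 1) * sc v0 l ^+ 2 * w 0 i = 0.
    apply/eqP; rewrite -(inj_eq (addrI (b 0 i + sc v0 l ^+ 2 * w 0 i + sc v0 l * w 0 i
       + (- b 0 i + (- sc v0 l) ^+ 2 * w 0 i + - sc v0 l * w 0 i)))) addr0 -{2}ea -{2}eb.
    by apply/eqP; ring.
  by move/eqP; rewrite !mulf_eq0 (negPf wi) (negPf nz2) (negPf lv0) /= !orbF.
(* The exponent is positive since [qcoef mu 0 = 0]. The rest of [e1] reads [S ^+ k.+1 = S + l *m w],
   and one factor [S] is cancelled. *)
case: k q1 e1 {kE} => [/eqP|k] q1 e1; first by rewrite eq_sym oner_eq0 in q1.
split=> //; exists mu, k; split=> //; apply: (can_inj (mulmxK Su)).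
rewrite mulmxDl mul1mx -scalemxAl -mulmxA wS -scalemxAr scalerA mulVf // scale1r.
apply: mulmx_ext => h; rewrite -[S ^+ k *m S]/(S ^+ k * S) -exprSr mulmxDr mul_outer.
have := e1 h; rewrite q1 mul1r addrAC => /addIr; exact.
Qed.

End QuadraticSkew.

(** * Pairs of a vector and a linear form in coordinates *)

Section Coordinates.
Variable F : fieldType.

Lemma complete_row n (w : 'rV[F]_n.+1) (i : 'I_n.+1) : w != 0 ->
  exists2 g : 'M_n.+1, g \in unitmx & delta_mx 0 i *m g = w.
Proof.
move=> w0; have dw : delta_mx 0 i *m (delta_mx i 0 *m w) = w.
  by rewrite mulmxA mul_delta_mx (_ : delta_mx _ _ = 1%:M) ?mul1mx //; 
    apply/matrixP=> a b; rewrite !ord1 !mxE.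
have rk (v : 'rV[F]_n.+1) : v != 0 -> \rank v = 1%N by rewrite rank_rV => ->.
have [|g gu gE] := @complete_unitmx _ _ _ (delta_mx 0 i : 'rV_n.+1) (delta_mx i 0 *m w).
  rewrite dw !rk //; apply/eqP=> /matrixP/(_ 0 i)/eqP.
  by rewrite !mxE !eqxx oner_eq0.
by exists g; rewrite // -gE.
Qed.

(** First [w] is completed to a basis as its first vector. In that basis [l] has first coordinate
    zero, so a block-diagonal change of basis fixing the first vector can bring [l] to the last
    coordinate form. *)
Lemma unitmx_pair n (w : 'rV[F]_n.+2) (l : 'cV_n.+2) :
    w != 0 -> l != 0 -> w *m l = 0 ->
  exists2 g : 'M_n.+2, g \in unitmx &
    delta_mx 0 0 *m g = w /\ g *m l = delta_mx ord_max 0.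
Proof.
move=> w0 l0 wl; have [g1 g1u g1E] := complete_row 0 w0.
pose l1 : 'cV_(1 + n.+1) := g1 *m l.
have l1u : usubmx l1 = 0.
  apply/matrixP=> i j; rewrite !ord1 !mxE.
  have := wl; rewrite -g1E -mulmxA => /matrixP/(_ 0 0).
  rewrite -rowE !mxE => e; rewrite -[RHS]e; apply: eq_bigr => k _.
  by congr (g1 _ _ * _); apply: val_inj.
pose l2 := dsubmx l1.
have l2n0 : l2^T != 0.
  rewrite -trmx0 (inj_eq (@trmx_inj _ _ _)); apply: contraNneq l0 => l20.
  apply/eqP/(can_inj (mulKmx g1u)); rewrite -/l1 -[l1]vsubmxK l1u -/l2 l20 mulmx0.
  exact: (col_mx0 F 1 n.+1 1).
have [h hu hE] := complete_row ord_max l2n0.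
pose H : 'M_(1 + n.+1) := block_mx 1%:M 0 0 h^T.
have Hu : H \in unitmx.
  by rewrite unitmxE det_ublock det1 mul1r det_tr -unitmxE.
pose e0 : 'rV[F]_(1 + n.+1) := row_mx 1%:M 0.
have e0E : e0 = delta_mx 0 0.
  have -> : e0 = row_mx (delta_mx 0 0) 0.
    by congr row_mx; apply/matrixP=> i j; rewrite !ord1 !mxE.
  by rewrite -delta_mx_lshift; congr delta_mx; exact: val_inj.
pose e1 : 'cV[F]_(1 + n.+1) := col_mx 0 (delta_mx ord_max 0).
have e1E : e1 = delta_mx ord_max 0.
  by rewrite /e1 -delta_mx_dshift; congr delta_mx; exact: val_inj.
have He : e0 *m H = e0.
  by rewrite mul_row_block !mulmx1 !mulmx0 mul0mx !addr0.
have Hl : H *m e1 = l1.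
  rewrite mul_block_col !mulmx0 !mul0mx !add0r -[l1]vsubmxK l1u; congr col_mx.
  by apply: trmx_inj; rewrite trmx_mul trmxK trmx_delta hE.
rewrite e0E in He; rewrite e1E in Hl.
exists (invmx H *m g1); first by rewrite unitmx_mul unitmx_inv Hu.
split; last by rewrite -mulmxA -/l1 -Hl mulKmx.
by rewrite mulmxA -[in LHS]He mulmxK // g1E.
Qed.

(** [mx2] and [mx3] are the shapes forced by [mx2P] and [mx3P]: the first row vector and the last
    column vector are eigenvectors for the same eigenvalue [a], hence the repeated corner entry. *)
Definition mx2 (a e : F) : 'M[F]_2 :=
  \matrix_(i, j) nth 0 (nth [::] [:: [:: a; 0]; [:: e; a]] i) j.

Definition mx3 (a n b c e : F) : 'M[F]_3 :=
  \matrix_(i, j) nth 0 (nth [::] [:: [:: a; 0; 0]; [:: b; n; 0]; [:: e; c; a]] i) j.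

Lemma mx2M a e a' e' : mx2 a e * mx2 a' e' = mx2 (a * a') (e * a' + a * e').
Proof.
apply/matrixP=> i j; rewrite !mxE !big_ord_recr big_ord0 /= !mxE /=.
by case: i => [[|[|i]] // hi]; case: j => [[|[|j]] // hj]; rewrite /=; ring.
Qed.

Lemma mx3M a n b c e a' n' b' c' e' :
  mx3 a n b c e * mx3 a' n' b' c' e' =
  mx3 (a * a') (n * n') (b * a' + n * b') (c * n' + a * c') (e * a' + c * b' + a * e').
Proof.
apply/matrixP=> i j; rewrite !mxE !big_ord_recr big_ord0 /= !mxE /=.
by case: i => [[|[|[|i]]] // hi]; case: j => [[|[|[|j]]] // hj]; rewrite /=; ring.
Qed.

Lemma mx2_1 : mx2 1 0 = 1.
Proof.
apply/matrixP=> i j; rewrite !mxE.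
by case: i => [[|[|i]] // hi]; case: j => [[|[|j]] // hj].
Qed.

Lemma mx3_1 : mx3 1 1 0 0 0 = 1.
Proof.
apply/matrixP=> i j; rewrite !mxE.
by case: i => [[|[|[|i]]] // hi]; case: j => [[|[|[|j]]] // hj].
Qed.

Lemma mx2P (M : 'M[F]_2) a :
    delta_mx 0 0 *m M = a *: delta_mx 0 0 :> 'rV_2 ->
    M *m delta_mx ord_max 0 = a *: delta_mx ord_max 0 :> 'cV_2 ->
  exists e, M = mx2 a e.
Proof.
rewrite -rowE -colE => /rowP r /colP c; exists (M 1 0).
have r0 := r 0; have r1 := r 1; have c1 := c 1; rewrite !mxE /= in r0 r1 c1.
apply/matrixP=> i j; rewrite !mxE.
case: i => [[|[|i]] // hi]; case: j => [[|[|j]] // hj] /=.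
- rewrite -[RHS]mulr1 -r0; congr (M _ _); exact: val_inj.
- rewrite -[RHS](mulr0 a) -r1; congr (M _ _); exact: val_inj.
- congr (M _ _); exact: val_inj.
- rewrite -[RHS]mulr1 -c1; congr (M _ _); exact: val_inj.
Qed.

Lemma mx3P (M : 'M[F]_3) a :
    delta_mx 0 0 *m M = a *: delta_mx 0 0 :> 'rV_3 ->
    M *m delta_mx ord_max 0 = a *: delta_mx ord_max 0 :> 'cV_3 ->
  exists n b c e, M = mx3 a n b c e.
Proof.
rewrite -rowE -colE => /rowP r /colP c.
have o2 : ord_max = 2%:R :> 'I_3 by exact: val_inj.
exists (M 1 1), (M 1 0), (M ord_max 1), (M ord_max 0).
have r0 := r 0; have r1 := r 1; have r2 := r ord_max.
have c1 := c 1; have c2 := c ord_max; rewrite !mxE /= in r0 r1 r2 c1 c2.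
apply/matrixP=> i j; rewrite !mxE.
case: i => [[|[|[|i]]] // hi]; case: j => [[|[|[|j]]] // hj] /=.
- rewrite -[RHS]mulr1 -r0; congr (M _ _); exact: val_inj.
- rewrite -[RHS](mulr0 a) -r1; congr (M _ _); exact: val_inj.
- rewrite -[RHS](mulr0 a) -r2; congr (M _ _); exact: val_inj.
- congr (M _ _); exact: val_inj.
- congr (M _ _); exact: val_inj.
- rewrite -[RHS](mulr0 a) -c1; congr (M _ _); exact: val_inj.
- congr (M _ _); exact: val_inj.
- congr (M _ _); exact: val_inj.
- rewrite -[RHS]mulr1 -c2; congr (M _ _); exact: val_inj.
Qed.

Lemma mx2_inj a e a' e' : mx2 a e = mx2 a' e' -> a = a' /\ e = e'.
Proof.
by move/matrixP=> E; have := E 0 0; have := E 1 0; rewrite !mxE /= => -> ->.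
Qed.

Lemma mx3_inj a n b c e a' n' b' c' e' :
  mx3 a n b c e = mx3 a' n' b' c' e' -> [/\ a = a', n = n', b = b', c = c' & e = e'].
Proof.
move/matrixP=> E; have := E 0 0; have := E 1 1; have := E 1 0.
have := E ord_max 1; have := E ord_max 0; rewrite !mxE /=.
by move=> -> -> -> -> ->.
Qed.

Lemma mx2X a e k : mx2 a e ^+ k = mx2 (a ^+ k) (e * (k%:R * a ^+ k.-1)).
Proof.
elim: k => [|k IH]; first by rewrite !expr0 mul0r mulr0 mx2_1.
rewrite exprSr IH mx2M -exprSr; congr mx2.
by case: k {IH} => [|k]; rewrite ?expr0 /= ?exprS -?natr1; ring.
Qed.

(* The off-diagonal entries of powers of [mx3 a n b c e]. *)
Fixpoint hcoef (a n : F) k : F :=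
  if k is k'.+1 then hcoef a n k' * a + n ^+ k' else 0.
Fixpoint gcoef (a n : F) k : F :=
  if k is k'.+1 then gcoef a n k' * a + hcoef n a k' else 0.

Lemma mx3X a n b c e k : mx3 a n b c e ^+ k =
  mx3 (a ^+ k) (n ^+ k) (b * hcoef a n k) (c * hcoef n a k)
      (e * (k%:R * a ^+ k.-1) + b * c * gcoef a n k).
Proof.
elim: k => [|k IH]; first by rewrite !expr0 /= !mulr0 !mul0r !mulr0 addr0 mx3_1.
rewrite exprSr IH mx3M -!exprSr; congr mx3 => /=; try by ring.
by case: k {IH} => [|k]; rewrite ?expr0 /= ?exprS -?natr1; ring.
Qed.

(** [hcoef a n k] is the geometric sum of the monomials of degree [k - 1] in [a] and [n]. *)
Lemma hcoef_sub a n k : hcoef a n k * (a - n) = a ^+ k - n ^+ k.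
Proof.
elim: k => [|k IH] /=; first by rewrite !expr0; ring.
rewrite !exprS mulrDl -mulrA [a * _]mulrC mulrA IH; ring.
Qed.

Lemma hcoef_diag a k : hcoef a a k = k%:R * a ^+ k.-1.
Proof.
elim: k => [|k IH] /=; first by rewrite mul0r.
by rewrite IH; case: k {IH} => [|k]; rewrite ?expr0 /= ?exprS -?natr1; ring.
Qed.

Lemma mx3_cube b c e : (mx3 1 1 b c e - 1) ^+ 3 = 0.
Proof.
have -> : mx3 1 1 b c e - 1 = mx3 0 0 b c e.
  apply/matrixP=> i j; rewrite !mxE.
  by case: i => [[|[|[|i]]] // hi]; case: j => [[|[|[|j]]] // hj]; rewrite /= ?subr0 ?subrr.
rewrite !exprS expr0 mulr1 !mx3M; apply/matrixP=> i j; rewrite !mxE.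
by case: i => [[|[|[|i]]] // hi]; case: j => [[|[|[|j]]] // hj]; rewrite /= ?subr0; ring.
Qed.

Lemma mx2_cube e : (mx2 1 e - 1) ^+ 3 = 0.
Proof.
have -> : mx2 1 e - 1 = mx2 0 e.
  apply/matrixP=> i j; rewrite !mxE.
  by case: i => [[|[|i]] // hi]; case: j => [[|[|j]] // hj]; rewrite /= ?subr0 ?subrr.
rewrite !exprS expr0 mulr1 !mx2M; apply/matrixP=> i j; rewrite !mxE.
by case: i => [[|[|i]] // hi]; case: j => [[|[|j]] // hj]; rewrite /= ?subr0; ring.
Qed.

Lemma unipotentX n (Q : 'M[F]_n) k : Q ^+ 3 = 0 ->
  (1 + Q) ^+ k = 1 + k%:R *: Q + 'C(k, 2)%:R *: Q ^+ 2.
Proof.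
move=> Q3; elim: k => [|k IH]; first by rewrite expr0 !scale0r !addr0.
rewrite exprSr IH mulrDr mulr1 !mulrDl mul1r -!mulmxE -!scalemxAl !mulmxE.
rewrite -expr2 -exprSr Q3 scaler0 addr0.
rewrite binS bin1 natrD -natr1 !scalerDl scale1r !addrA; congr (_ + _).
by rewrite addrAC.
Qed.

Lemma outerX n (l : 'cV[F]_n) (w : 'rV_n) c k : w *m l = 0 ->
  (1 + c *: (l *m w)) ^+ k = 1 + (k%:R * c) *: (l *m w).
Proof.
move=> wl; elim: k => [|k IH]; first by rewrite expr0 mul0r scale0r addr0.
rewrite exprSr IH mulrDr mulr1 mulrDl mul1r -!mulmxE -scalemxAl -scalemxAr.
rewrite [X in _ + (_ + _ *: (_ *: X))]mulmxA -[l *m w *m l]mulmxA wl mulmx0 mul0mx.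
by rewrite !scaler0 addr0 -addrA -scalerDl -natr1 mulrDl mul1r.
Qed.

Lemma outer_eq0 n (l : 'cV[F]_n) (w : 'rV_n) : l != 0 -> w != 0 -> l *m w != 0.
Proof.
move=> /cV0Pn[i li] /rV0Pn[j wj]; apply/eqP=> /matrixP/(_ i j)/eqP.
by rewrite !mxE big_ord1 mulf_eq0 (negPf li) (negPf wj).
Qed.

Lemma conjmxX n (g S : 'M[F]_n) k : g \in unitmx ->
  (g *m S *m invmx g) ^+ k = g *m S ^+ k *m invmx g.
Proof.
move=> gu; elim: k => [|k IH]; first by rewrite !expr0 mulmx1 mulmxV.
rewrite !exprSr IH -!mulmxE.
by rewrite !mulmxA mulmxKV.
Qed.

Lemma conj_eigen n (g S : 'M[F]_n.+2) (w : 'rV_n.+2) (l : 'cV_n.+2) mu :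
    g \in unitmx -> delta_mx 0 0 *m g = w -> g *m l = delta_mx ord_max 0 ->
    w *m S = mu *: w -> S *m l = mu *: l ->
  delta_mx 0 0 *m (g *m S *m invmx g) = mu *: delta_mx 0 0 :> 'rV_n.+2 /\
  (g *m S *m invmx g) *m delta_mx ord_max 0 = mu *: delta_mx ord_max 0 :> 'cV_n.+2.
Proof.
move=> gu gw gl wS Sl; split.
  by rewrite !mulmxA gw wS -scalemxAl -gw mulmxK.
by rewrite -gl -!mulmxA mulKmx // Sl -scalemxAr.
Qed.

End Coordinates.

(** * The power [S ^+ p.-1] and the normalisation of [(l, w)] *)

Section PredPower.
Variable p : nat.
Hypothesis p_prime : prime p.
Local Notation F := 'F_p.

Lemma Fp_exp_pred (x : F) : x != 0 -> x ^+ p.-1 = 1.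
Proof.
move=> x0; apply: (mulfI x0); rewrite -exprS prednK ?prime_gt0 // mulr1.
exact: Fp_expp.
Qed.

Lemma natr_pred : p.-1%:R = -1 :> F.
Proof.
by apply: (addIr 1); rewrite natr1 prednK ?prime_gt0 // natr_p0 // addNr.
Qed.

(** Put [S ^+ p.-1 = 1 + Q] and compute [S ^+ (k * p.-1)] twice: [k Q + C(k, 2) Q^2 = - c l w]. If p
    divided [k], the left side would vanish, p being odd. Multiplying by [Q] on the right kills
    [l w], so [Q^2 = 0] and [Q] is a multiple of [l w]. *)
Lemma transvection_power n (S : 'M[F]_n) l w mu k c : p <> 2%N ->
    l != 0 -> w != 0 -> sc w l = 0 -> mu != 0 -> w *m S = mu *: w ->
    (S ^+ p.-1 - 1) ^+ 3 = 0 -> c != 0 -> S ^+ k = 1 + c *: (l *m w) ->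
  k%:R != 0 :> F /\ exists2 d, d != 0 & S ^+ p.-1 = 1 + d *: (l *m w).
Proof.
move=> p2 l0 w0 wl mu0 wS Q3 c0 Sk.
set Q := S ^+ p.-1 - 1 in Q3; set E := l *m w in Sk *.
have E0 : E != 0 by exact: outer_eq0.
have wQ : w *m Q = 0.
  by rewrite mulmxBr (mulmx_eigen _ wS) Fp_exp_pred // scale1r mulmx1 subrr.
have wl0 : w *m l = 0 by rewrite scE wl raddf0.
have SQ : S ^+ p.-1 = 1 + Q by rewrite addrC subrK.
have e : k%:R *: Q + 'C(k, 2)%:R *: Q ^+ 2 = - c *: E.
  apply: (@addrI _ 1); rewrite addrA -unipotentX // -SQ -exprM mulnC exprM Sk.
  by rewrite outerX // natr_pred mulN1r.
have k0 : k%:R != 0 :> F.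
  apply: contraNneq E0 => k0; have C0 : 'C(k, 2)%:R = 0 :> F.
    apply: (mulfI (two_neq0 p_prime p2)); rewrite -natrM mulr0.
    have -> : (2 * 'C(k, 2) = k * k.-1)%N by rewrite -mul_bin_diag bin1.
    by rewrite natrM k0 mul0r.
  move: e; rewrite k0 C0 !scale0r addr0 => /esym/eqP.
  by rewrite scaler_eq0 oppr_eq0 (negPf c0).
split=> //.
have Q2 : Q ^+ 2 = 0.
  have EQ : E *m Q = 0 by rewrite -mulmxA wQ mulmx0.
  have := congr1 (mulmxr Q) e; rewrite /= mulmxDl -!scalemxAl EQ scaler0.
  rewrite !mulmxE -expr2 -exprSr Q3 scaler0 addr0.
  by move/eqP; rewrite scaler_eq0 (negPf k0) => /eqP.
exists (k%:R^-1 * - c); first by rewrite mulf_neq0 ?invr_eq0 ?oppr_eq0.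
by rewrite SQ -scalerA -e Q2 scaler0 addr0 scalerA mulVf // scale1r.
Qed.

(* This is where the dimension is used: [S ^+ p.-1] is unitriangular of size at
   most 3. *)
Lemma pred_power_cube n (S : 'M[F]_n) l w mu k c : n = 2%N \/ n = 3%N ->
    l != 0 -> w != 0 -> sc w l = 0 -> mu != 0 -> w *m S = mu *: w ->
    S *m l = mu *: l -> c != 0 -> S ^+ k = 1 + c *: (l *m w) ->
  (S ^+ p.-1 - 1) ^+ 3 = 0.
Proof.
move=> n23 l0 w0 wl mu0 wS Sl c0 Sk.
have wl0 : w *m l = 0 by rewrite scE wl raddf0.
suff [g gu gE] : exists2 g, g \in unitmx &
    ((g *m S *m invmx g) ^+ p.-1 - 1) ^+ 3 = 0.
  have e : (g *m S *m invmx g) ^+ p.-1 - 1 = g *m (S ^+ p.-1 - 1) *m invmx g.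
    by rewrite conjmxX // mulmxBr mulmx1 mulmxBl mulmxV.
  have gVu : invmx g \in unitmx by rewrite unitmx_inv.
  apply: (can_inj (mulKmx gu)); apply: (can_inj (mulmxK gVu)).
  by rewrite mulmx0 mul0mx -conjmxX // -e.
case: n23 => en; subst n.
  have [g gu [gw gl]] := unitmx_pair w0 l0 wl0; exists g => //.
  have [r cc] := conj_eigen gu gw gl wS Sl.
  by have [e ->] := mx2P r cc; rewrite mx2X Fp_exp_pred // mx2_cube.
have [g gu [gw gl]] := unitmx_pair w0 l0 wl0; exists g => //.
have [r cc] := conj_eigen gu gw gl wS Sl.
have [nu [b [d [e E]]]] := mx3P r cc; rewrite E mx3X Fp_exp_pred // Fp_exp_pred ?mx3_cube //.
(* The middle eigenvalue is nonzero: the middle diagonal entry of the conjugate of [S ^+ k] is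
   [nu ^+ k] and equals 1, so [nu = 0] would force [k = 0] and then [c *: (l *m w) = 0]. *)
apply: contraTneq isT => nu0.
have := conjmxX S k gu; rewrite E Sk mx3X mulmxDr mulmx1 mulmxDl mulmxV //.
rewrite -scalemxAr -scalemxAl mulmxA gl -mulmxA.
have -> : w *m invmx g = delta_mx 0 0 by rewrite -gw mulmxK.
rewrite mul_delta_mx nu0 => /matrixP E1.
have := E1 1 1; rewrite !mxE /= mulr0 addr0 => /eqP; rewrite expr0n.
case: k Sk E1 => [|k] Sk E1; last by rewrite eq_sym oner_eq0.
have /eqP : c *: (l *m w) = 0 by apply: (@addrI _ 1); rewrite -Sk addr0.
by rewrite scaler_eq0 (negPf c0) (negPf (outer_eq0 l0 w0)).
Qed.

(* [S ^+ p.-1 = 1 + l *m w] normalises [(l, w)] among the pairs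
   [(a l, a^-2 w)] that define the same map [v S + l(v)^2 w]. *)
Definition admissible n (S : 'M[F]_n) (l : 'cV[F]_n) (w : 'rV[F]_n) : bool :=
  [&& l != 0, w != 0, sc w l == 0, S ^+ p.-1 == 1 + l *m w &
      [exists mu, [&& mu != 0, mu != 1, w *m S == mu *: w & S *m l == mu *: l]]].

Lemma admissibleP n (S : 'M[F]_n) l w : reflect
  ([/\ l != 0, w != 0, sc w l = 0 & S ^+ p.-1 = 1 + l *m w] /\
   exists mu, [/\ mu != 0, mu != 1, w *m S = mu *: w & S *m l = mu *: l])
  (admissible S l w).
Proof.
apply: (iffP and5P) => [[-> -> /eqP-> /eqP-> /existsP[mu /and4P[m0 m1 /eqP wS /eqP Sl]]]|].
  by split=> //; exists mu.
case=> [[-> -> /eqP-> /eqP->] [mu [m0 m1 /eqP wS /eqP Sl]]]; split=> //.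
by apply/existsP; exists mu; rewrite m0 m1 wS Sl.
Qed.

Lemma qcoef1 k : qcoef 1 k = k%:R :> F.
Proof. by elim: k => //= k ->; rewrite !expr1n mulr1 natr1. Qed.

(** Replacing [(l, w)] by [(d^-1 l, d^2 w)] keeps [l(v)^2 w] and multiplies [l w] by [d], the factor
    found by [transvection_power]. *)
Lemma skew_admissible n (s : {perm 'rV[F]_n}) S l w : n = 2%N \/ n = 3%N ->
    p <> 2%N -> askew s -> l != 0 -> w != 0 ->
    (forall v, s v = v *m S + sc v l ^+ 2 *: w) ->
  exists l' w', admissible S l' w' /\
    forall v, s v = v *m S + sc v l' ^+ 2 *: w'.
Proof.
move=> n23 p2 skew_s l0 w0 sE.
have [wl [mu [k [mu0 wS Sl Sk q1]]]] := skew_quadratic p_prime p2 skew_s l0 w0 sE.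
have muV : mu^-1 != 0 by rewrite invr_eq0.
have Q3 := pred_power_cube n23 l0 w0 wl mu0 wS Sl muV Sk.
have [k0 [d d0 Sd]] := transvection_power p2 l0 w0 wl mu0 wS Q3 muV Sk.
exists (d^-1 *: l), (d ^+ 2 *: w); split; last first.
  by move=> v; rewrite sE scZr scalerA; congr (_ + _ *: _); field.
apply/admissibleP; split.
  split; rewrite ?scaler_eq0 ?invr_eq0 ?negb_or ?d0 ?expf_neq0 //.
    by rewrite scZ scZr wl !mulr0.
  rewrite Sd -scalemxAl -scalemxAr scalerA; congr (_ + _ *: _); by field.
exists mu; split=> //; last first.
- by rewrite -scalemxAr Sl !scalerA mulrC.
- by rewrite -scalemxAl wS !scalerA mulrC.
(* For [mu = 1], the relation [qcoef mu k.+1 = 1] reads [k + 1 = 1] in the field. *)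
apply: contraNneq k0 => m1; apply/eqP; apply: (addIr 1).
by move: q1; rewrite m1 qcoef1 -natr1 add0r.
Qed.

End PredPower.

(** * Enlarging a preserved line to a preserved hyperplane *)

Section Hyperplane.
Variable p : nat.
Hypothesis p_prime : prime p.
Local Notation F := 'F_p.

Lemma qcoef_sub (mu : F) k :
  qcoef mu k * (mu ^+ 2 - mu) = mu ^+ k ^+ 2 - mu ^+ k.
Proof.
elim: k => [|k IH] /=; first by rewrite mul0r expr0 expr1n subrr.
rewrite mulrDl mulrAC IH [mu ^+ k.+1]exprS; ring.
Qed.

Lemma qcoef_pred (mu : F) : mu != 0 -> mu != 1 -> qcoef mu p.-1 = 0.
Proof.
move=> m0 m1; have := qcoef_sub mu p.-1; rewrite Fp_exp_pred // expr1n subrr => /eqP.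
rewrite mulf_eq0 => /orP[/eqP //|].
by rewrite expr2 -{3}[mu]mulr1 -mulrBr mulf_eq0 (negPf m0) subr_eq0 (negPf m1).
Qed.

(** By Fermat the quadratic coefficient of this iterate vanishes, so a transvection remains. *)
Lemma admissible_expg n (s : {perm 'rV[F]_n}) S l w : admissible S l w ->
    (forall v, s v = v *m S + sc v l ^+ 2 *: w) ->
  forall v, (s ^+ p.-1)%g v = v + sc v l *: w.
Proof.
move=> /admissibleP[[l0 w0 wl Sp] [mu [m0 m1 wS Sl]]] sE v.
rewrite (quadratic_expg sE wl wS Sl) qcoef_pred // mul0r scale0r addr0 Sp.
by rewrite mulmxDr mulmx1 mul_outer.
Qed.

(** On the line ker Q, [s] is additive, hence a scalar; Fermat applies to that scalar when the line
    is nonzero. *)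
Lemma line_fix n m (s : {perm 'rV[F]_n}) (Q : 'M_(n, m)) (a0 : 'rV_n) :
    askew s -> preserved s Q ->
    (forall a, a *m Q = 0 <-> exists c, a = c *: a0) ->
  forall a, a *m Q = 0 -> (s ^+ p.-1)%g a = a.
Proof.
move=> skew_s sQ line a aQ.
have s0 : s 0 = 0 by case: skew_s.
have a0Q : a0 *m Q = 0 by apply/line; exists 1; rewrite scale1r.
have [/line[la sa0] _] := sQ _ a0Q.
have sX k : s (a0 *+ k) = s a0 *+ k.
  by elim: k => [|k IH]; rewrite ?mulr0n // !mulrS; have [_ ->] := sQ _ a0Q; rewrite IH.
have sla b : b *m Q = 0 -> s b = la *: b.
  by move=> /line[c ->]; rewrite scaleE sX sa0 -!scalerMnr.
have skla k : (s ^+ k)%g a = la ^+ k *: a.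
  elim: k => [|k IH]; first by rewrite expg0 perm1 scale1r.
  by rewrite expgSr permM IH sla ?scalerA ?exprS // -scalemxAl aQ scaler0.
have [a00|a00] := eqVneq a 0.
  by rewrite a00 (askew_cycle0 skew_s) // mem_cycle.
rewrite skla Fp_exp_pred ?scale1r //; apply: contraNneq a00 => la0.
by apply/eqP/(@perm_inj _ s); rewrite s0 sla // la0 scale0r.
Qed.

(* With [T = ker_cycle s Q] and [tau = s ^+ p.-1], which is a transvection
   modulo [N = ker Q], the group [T] is generated by a power of [tau ^+ p];
   skewness makes [tau] quadratic on lines [h + i b], so [tau ^+ p = 1]. *)
Lemma preserved_hyperplane n m (s : {perm 'rV[F]_n}) (Q : 'M_(n, m)) R
    (t : {perm 'rV[F]_m}) (a0 : 'rV_n) S l w : p <> 2%N ->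
    askew s -> preserved s Q -> R *m Q = 1%:M ->
    (forall a, a *m Q = 0 <-> exists c, a = c *: a0) ->
    (forall k v, (t ^+ k)%g (v *m Q) = (s ^+ k)%g v *m Q) ->
    admissible S l w -> (forall v, t v = v *m S + sc v l ^+ 2 *: w) ->
  preserved s (Q *m l).
Proof.
move=> p2 skew_s sQ RQ line tE adm tquad.
have [[l0 w0 wl Sp] [mu [m0 m1 wS Sl]]] := admissibleP _ _ _ adm.
pose L h := sc (h *m Q) l.
have LD x y : L (x + y) = L x + L y by rewrite /L mulmxDl scD.
pose tau : {perm 'rV[F]_n} := (s ^+ p.-1)%g.
have taus : tau \in <[s]>%g by exact: mem_cycle.
have tauN a : a *m Q = 0 -> tau a = a by exact: line_fix line _.
have tauQ h : tau h *m Q = h *m Q + L h *: w.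
  by rewrite -tE (admissible_expg adm tquad).
have tauXQ k h : (tau ^+ k)%g h *m Q = h *m Q + (k%:R * L h) *: w.
  have Lt x : L (tau x) = L x by rewrite /L tauQ scD scZ wl mulr0 addr0.
  have LX j : L ((tau ^+ j)%g h) = L h.
    elim: j => [|j IH]; first by rewrite expg0 perm1.
    by rewrite expgSr permM Lt IH.
  elim: k => [|k IH]; first by rewrite expg0 perm1 mul0r scale0r addr0.
  by rewrite expgSr permM tauQ IH LX -addrA -scalerDl -natr1 mulrDl mul1r.
have tauNh a h : a *m Q = 0 -> tau (h + a) = tau h + a.
  by move=> aQ; rewrite addrC; have [_ ->] := preserved_cycle sQ taus aQ; rewrite tauN // addrC.
have tauW b k : L b = 0 -> (tau ^+ k)%g b = b + (tau b - b) *+ k.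
  move=> Lb; have bQ : (tau b - b) *m Q = 0.
    by rewrite mulmxBl tauQ Lb scale0r addr0 subrr.
  elim: k => [|k IH]; first by rewrite expg0 perm1 addr0.
  rewrite expgSr permM IH tauNh; last by rewrite -scaler_nat -scalemxAl bQ scaler0.
  by rewrite mulrS addrA [b + _]addrC subrK.
have [t0 t0E] := ker_cycle_generator s Q.
have t0K : t0 \in ker_cycle s Q by rewrite -t0E cycle_id.
have [t0s t0N t0Q] := ker_cycleP _ _ _ t0K.
have uD := ker_cycle_additive p_prime skew_s sQ t0E.
have t0p : (t0 ^+ p = 1)%g.
  by apply/permP=> h; rewrite (ker_cycle_expg sQ) // mulrnp // addr0 perm1.
(* As [t0 ^+ p = 1] and [(p - 1)^2] is 1 modulo p, [t0] is a power of [tau]. Modulo ker Q it is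
   trivial while [tau] is a nontrivial transvection, so p divides the exponent. *)
have [K t0tau] : exists K, t0 = ((tau ^+ p) ^+ K)%g.
  case/cycleP: t0s => k ek; pose K := (k * p.-1)%N.
  have e : t0 = (tau ^+ K)%g.
    rewrite /tau /K -expgM mulnCA expgM -ek.
    have -> : (p.-1 * p.-1 = p * p.-2 + 1)%N.
      by case: (p) (prime_gt1 p_prime) => [|[|q]] //= _; rewrite !mulSn mulnS addn1 !addSn.
    by rewrite expgD expgM t0p expg1n mul1g.
  have [v0 lv0] := sc_neq0 l0.
  have : (p %| K)%N.
    rewrite (dvdn_pcharf (pchar_Fp p_prime)).
    have := t0Q (v0 *m R); rewrite e tauXQ /L -mulmxA RQ mulmx1 => /eqP.
    rewrite -[X in _ == X]addr0 (inj_eq (addrI _)) scaler_eq0 (negPf w0) orbF mulf_eq0.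
    by rewrite (negPf lv0) orbF.
  by case/dvdnP=> K' eK; exists K'; rewrite -expgM mulnC -eK.
(* On the hyperplane [L b = 0] the displacements of [tau] are constant along iterates, so [tau ^+ p]
   and its power [t0] act trivially there. *)
have uW b : L b = 0 -> t0 b = b.
  move=> Lb; have pb : (tau ^+ p)%g b = b by rewrite tauW // mulrnp // addr0.
  rewrite t0tau; elim: (K) => [|j IH]; first by rewrite expg0 perm1.
  by rewrite expgS permM pb.
have Ltau h : L (tau h - h) = 0.
  by rewrite /L mulmxBl tauQ addrC addKr scZ wl mulr0.
have tau_skew b : L b = 0 -> exists j, forall h,
    tau (b + h) = tau b + tau h + (t0 h - h) *+ j.
  move=> Lb; have [|z] := @cycle_defect _ _ _ _ _ skew_s sQ tau b taus.
    move=> h; rewrite !mulmxBl !tauQ LD Lb add0r scale0r addr0 mulmxDl.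
    move: (b *m Q) (h *m Q) (L h *: w) => A B C.
    by apply/rowP=> q; rewrite !mxE; ring.
  rewrite -t0E => /cycleP[j ->] zE; exists j => h.
  rewrite zE (ker_cycle_expg sQ j (tau h) t0K) addrA; congr (_ + _ *+ j).
  have := uD (tau h - h) h; rewrite /= subrK => ->.
  by rewrite uW ?Ltau // subrr add0r.
(* With [b = tau h - h], iteration gives [h + i b + C(i, 2) n1] for a fixed [n1] in ker Q, and p
   divides [C(p, 2)] because p is odd. *)
have taup : (tau ^+ p = 1)%g.
  apply/permP=> h; rewrite perm1; pose b := tau h - h.
  have [j jE] := tau_skew b (Ltau h).
  pose n1 := (tau b - b) + (t0 h - h) *+ j.
  have n1Q : n1 *m Q = 0.
    have bQ : (tau b - b) *m Q = 0.
      by rewrite mulmxBl tauQ Ltau scale0r addr0 subrr.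
    by rewrite mulmxDl bQ -scaler_nat -scalemxAl mulmxBl t0Q subrr scaler0 addr0.
  have Lbi i : L (b *+ i) = 0.
    by rewrite -scaler_nat /L -scalemxAl scZ -/(L b) (Ltau h : L b = 0) mulr0.
  have ub i : t0 (h + b *+ i) - (h + b *+ i) = t0 h - h.
    by rewrite uD /= [t0 (b *+ i)]uW // subrr addr0.
  have step i : tau (h + b *+ i) = h + b *+ i.+1 + n1 *+ i.
    elim: i => [|i IH]; first by rewrite mulr0n !addr0 mulr1n addrC subrK.
    have -> : h + b *+ i.+1 = b + (h + b *+ i) by rewrite mulrS addrCA.
    rewrite jE ub IH [n1 *+ i.+1]mulrSr [b *+ i.+2]mulrSr {3}/n1.
    move: (n1 *+ i) (b *+ i.+1) (tau b) ((t0 h - h) *+ j) => N B T U.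
    by apply/rowP=> q; rewrite !mxE; ring.
  have tauX i : (tau ^+ i)%g h = h + b *+ i + n1 *+ 'C(i, 2).
    elim: i => [|i IH]; first by rewrite expg0 perm1 !addr0.
    rewrite expgSr permM IH tauNh ?step; last by rewrite -scaler_nat -scalemxAl n1Q scaler0.
    by rewrite -addrA -mulrnDr binS bin1 addnC.
  rewrite tauX mulrnp // addr0.
  have /dvdnP[c ->] : (p %| 'C(p, 2))%N.
    by apply: prime_dvd_bin; rewrite //= ltn_neqAle prime_gt1 // andbT; apply/eqP=> /esym.
  by rewrite mulnC mulrnA mulrnp // mul0rn addr0.
(* Thus [ker_cycle] is trivial, and [cycle_defect] turns additivity modulo ker Q along the
   hyperplane into exact additivity. *)
have t01 : t0 = 1%g by rewrite t0tau taup expg1n.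
move=> b; rewrite mulmxA => bQl.
have Lb : L b = 0 by rewrite /L /sc bQl mxE.
have sE h : s h *m Q = h *m Q *m S + L h ^+ 2 *: w.
  by have := tE 1%N h; rewrite !expg1 => <-; exact: tquad.
split.
  by rewrite mulmxA sE Lb expr0n scale0r addr0 -mulmxA Sl -scalemxAr bQl scaler0.
move=> h; have [|z] := @cycle_defect _ _ _ _ _ skew_s sQ s b (cycle_id s).
  move=> k; rewrite !mulmxBl !sE LD Lb add0r expr0n scale0r addr0 !mulmxDl.
  move: (b *m Q *m S) (k *m Q *m S) (L k ^+ 2 *: w) => A B C.
  by apply/rowP=> q; rewrite !mxE; ring.
by rewrite -t0E t01 cycle1 => /set1P -> ->; rewrite perm1.
Qed.

End Hyperplane.

(** * Classification in dimension at most three *)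

Section Classification.
Variable p : nat.
Hypothesis p_prime : prime p.
Local Notation F := 'F_p.

Definition linear_perm n (s : {perm 'rV[F]_n}) : Prop :=
  exists S, forall v, s v = v *m S.

Definition admissible_perm n (s : {perm 'rV[F]_n}) : Prop :=
  p <> 2%N /\ exists S l w,
    admissible S l w /\ forall v, s v = v *m S + sc v l ^+ 2 *: w.

Lemma classify_linear_quotient n m (s : {perm 'rV[F]_n}) (Q : 'M_(n, m)) S :
    n = 2%N \/ n = 3%N -> askew s -> preserved s Q ->
    (forall v, s v *m Q = v *m Q *m S) ->
  linear_perm s \/ admissible_perm s.
Proof.
move=> n23 skew_s sQ sS.
have [|lin|[p2 [M [l [w [l0 w0 sE]]]]]] := quadratic_of_quotient_additive p_prime skew_s sQ.
- by move=> b h; rewrite !mulmxBl !sS !mulmxDl addrAC addrK subrr.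
- by left.
right; split=> //; have [l' [w' [adm sE']]] := skew_admissible p_prime n23 p2 skew_s l0 w0 sE.
by exists M, l', w'.
Qed.

(** The quotient has dimension at most one, so the induced skew-morphism is linear. *)
Lemma classify2 (s : {perm 'rV[F]_2}) : askew s -> linear_perm s \/ admissible_perm s.
Proof.
move=> skew_s; have [//|m [Q [R [m2 RQ sQ]]]] := skew_preserved p_prime _ skew_s.
have [t skew_t tE] := skew_quotient skew_s sQ RQ.
have [S tS] : linear_perm t.
  case: m m2 Q R RQ sQ t skew_t tE => [|[|m]] // _ Q R RQ sQ t skew_t tE.
    by exists 1%:M => v; rewrite !thinmx0.
  exact: (skew_linear1 p_prime).
apply: (@classify_linear_quotient _ _ s Q S) => //; first by left.
by move=> v; rewrite -tS; have := tE 1%N v; rewrite !expg1.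
Qed.

Lemma ker_line (Q : 'M[F]_(3, 2)) R : R *m Q = 1%:M ->
  exists a0 : 'rV_3, forall a, a *m Q = 0 <-> exists c, a = c *: a0.
Proof.
move=> RQ; have Qf : row_full Q by apply/row_fullP; exists R.
have rk : \rank (kermx Q) = 1%N by rewrite mxrank_ker (eqP Qf).
have /rowV0Pn[a0 a0K a00] : kermx Q != 0 by rewrite -mxrank_eq0 rk.
have /andP[_ Ka0] : (a0 == kermx Q)%MS.
  by rewrite -(mxrank_leqif_eq a0K) rk rank_rV a00.
exists a0 => a; split=> [/sub_kermxP aK|[c ->]].
  by apply/sub_rVP; apply: submx_trans aK Ka0.
by rewrite -scalemxAl (sub_kermxP a0K) scaler0.
Qed.

Lemma classify3 (s : {perm 'rV[F]_3}) : askew s -> linear_perm s \/ admissible_perm s.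
Proof.
move=> skew_s; have [//|m [Q [R [m3 RQ sQ]]]] := skew_preserved p_prime _ skew_s.
have n3 : 3%N = 2%N \/ 3%N = 3%N by right.
have [t skew_t tE] := skew_quotient skew_s sQ RQ.
have tE1 v : t (v *m Q) = s v *m Q by have := tE 1%N v; rewrite !expg1.
have lin : linear_perm t -> linear_perm s \/ admissible_perm s.
  case=> S tS; apply: (@classify_linear_quotient _ _ s Q S) => //.
  by move=> v; rewrite -tS.
case: m m3 Q R RQ sQ t skew_t tE tE1 lin => [|[|[|m]]] // _ Q R RQ sQ t skew_t tE tE1 lin.
- by apply: lin; exists 1%:M => v; rewrite !thinmx0.
- exact: lin (skew_linear1 p_prime skew_t).
case: (classify2 skew_t) => [//|[p2 [S [l [w [adm tq]]]]]].
have [a0 line] := ker_line RQ.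
have [[l0 w0 wl _] [mu [m0 m1 wS Sl]]] := admissibleP _ _ _ adm.
have sQl := preserved_hyperplane p_prime p2 skew_s sQ RQ line tE adm tq.
(* Modulo the hyperplane ker (Q l), [s] is multiplication by [mu], since [w l = 0] and
   [S l = mu l]. *)
apply: (@classify_linear_quotient _ _ s (Q *m l) mu%:M) => // v.
rewrite !mulmxA -tE1 tq mulmxDl -mulmxA Sl -scalemxAr -scalemxAl.
by rewrite [w *m l]scE wl raddf0 scaler0 addr0 mul_mx_scalar.
Qed.

Lemma admissible_unit n (S : 'M[F]_n) l w : admissible S l w -> S \in unitmx.
Proof.
move=> /admissibleP[[_ _ wl Sp] _].
have wl0 : w *m l = 0 by rewrite scE wl raddf0.
have : S *m (S ^+ p.-2 *m (1%:M - l *m w)) = 1%:M.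
  rewrite mulmxA mulmxE -exprS prednK; last by rewrite -ltnS prednK ?prime_gt1 ?prime_gt0.
  rewrite Sp -mulmxE mulmxDl mul1mx mulmxBr mulmx1 -mulmxA [w *m _]mulmxA wl0.
  by rewrite mul0mx mulmx0 subr0 subrK.
by case/mulmx1_unit.
Qed.

Definition quad_map n (S : 'M[F]_n) l w (v : 'rV[F]_n) : 'rV[F]_n :=
  v *m S + sc v l ^+ 2 *: w.

(** Applying [l] to the image gives [mu l(x)], which determines the quadratic term; [S] is then
    inverted. *)
Lemma quad_map_inj n (S : 'M[F]_n) l w : admissible S l w -> injective (quad_map S l w).
Proof.
move=> adm x y; have Su := admissible_unit adm; rewrite /quad_map => e.
have [[_ _ wl _] [mu [m0 _ _ Sl]]] := admissibleP _ _ _ adm.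
have: sc (quad_map S l w x) l = sc (quad_map S l w y) l by rewrite /quad_map e.
rewrite !scD !scM !scZ wl !mulr0 !addr0 Sl !scZr => /(mulfI m0) exy.
by move: e; rewrite exy => /addIr /(can_inj (mulmxK Su)).
Qed.

Lemma admissible_skew n (s : {perm 'rV[F]_n}) S l w : admissible S l w ->
  (forall v, s v = v *m S + sc v l ^+ 2 *: w) -> askew s.
Proof.
move=> adm sE; have [[_ _ wl _] [mu [m0 _ wS Sl]]] := admissibleP _ _ _ adm.
split=> [|g]; first by rewrite sE mul0mx sc0 expr0n scale0r addr0.
(* The twist must add [2 l(g) l(h) w]. Applying [s ^+ p.-1] [t] times adds [t l(h) w], which the
   final [s] multiplies by [mu]. *)
pose t : F := 2%:R * sc g l / mu.
exists (p.-1 * t + 1)%N => h.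
have tau k : ((s ^+ p.-1) ^+ k)%g h = h + (k%:R * sc h l) *: w.
  elim: k => [|k IH]; first by rewrite expg0 perm1 mul0r scale0r addr0.
  rewrite expgSr permM IH (admissible_expg p_prime adm sE) scD scZ wl mulr0 addr0.
  by rewrite -addrA -scalerDl -natr1 mulrDl mul1r.
rewrite expgD expgM expg1 permM tau natr_Zp !sE !mulmxDl !scD scZ wl mulr0 addr0.
rewrite -scalemxAl wS scalerA -!addrA; congr (_ + _).
rewrite [RHS]addrCA; congr (_ + _); rewrite addrC -!scalerDl.
by congr (_ *: _); rewrite /t; field.
Qed.

Lemma linear_skew n (s : {perm 'rV[F]_n}) S : (forall v, s v = v *m S) -> askew s.
Proof.
move=> sE; split=> [|g]; first by rewrite sE mul0mx.
by exists 1%N => h; rewrite expg1 !sE mulmxDl.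
Qed.

Lemma linear_perm_unit n (s : {perm 'rV[F]_n}) S : (forall v, s v = v *m S) -> S \in unitmx.
Proof.
move=> sE; rewrite -row_free_unit -kermx_eq0; apply/eqP/row_matrixP=> j.
apply: (@perm_inj _ s); rewrite !sE -row_mul mulmx_ker !row0 mul0mx //.
Qed.

End Classification.

(** * Embedding into the affine group *)

Section Transport.
Variables (T U : finType) (f : T -> U) (f' : U -> T).
Hypotheses (fK : cancel f f') (f'K : cancel f' f).

Definition transport_perm (x : {perm T}) : {perm U} :=
  perm (inj_comp (can_inj fK) (inj_comp (@perm_inj _ x) (can_inj f'K))).

Lemma transport_permE x u : transport_perm x u = f (x (f' u)).
Proof. by rewrite permE. Qed.

Lemma transport_permM : {in [set: {perm T}] &, {morph transport_perm : x y / (x * y)%g}}.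
Proof. by move=> x y _ _; apply/permP=> u; rewrite permM !transport_permE permM fK. Qed.

Canonical transport_morphism := Morphism transport_permM.

Lemma isog_transport (X : {group {perm T}}) :
  (X \isog (transport_morphism @* X))%g.
Proof.
apply: (sub_isog (subsetT _)); apply/injmP=> x y _ _ /permP E; apply/permP=> a.
by have := E (f a); rewrite !transport_permE fK => /(can_inj fK).
Qed.

End Transport.

Section Affine.
Variable p : nat.
Hypothesis p_prime : prime p.
Local Notation F := 'F_p.

Lemma AGLP n (x : {perm 'rV[F]_n}) A b : A \in unitmx ->
  (forall v, x v = v *m A + b) -> x \in AGL n p.
Proof.
move=> uA xE; rewrite inE; apply/existsP; exists A; apply/existsP; exists b.
by rewrite uA; apply/forallP=> v; rewrite xE.
Qed.

Lemma skew_transport (gT : finGroupType) n (f : gT -> 'rV[F]_n) f'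
    (fK : cancel f f') (f'K : cancel f' f) (s : {perm gT}) :
  (forall x y, f (x * y)%g = f x + f y) -> skew_morphism s ->
  askew (transport_perm fK f'K s).
Proof.
move=> fM [s1 [pi sE]].
have f1 : f 1%g = 0 by apply: (@addrI _ (f 1%g)); rewrite -fM mulg1 addr0.
have tX k v : ((transport_perm fK f'K s) ^+ k)%g v = f ((s ^+ k)%g (f' v)).
  elim: k => [|k IH]; first by rewrite !expg0 !perm1 f'K.
  by rewrite !expgSr !permM IH transport_permE fK.
split=> [|g]; first by rewrite transport_permE -f1 fK s1.
have /cycleP[k ek] := perm_expz_cycle s (pi (f' g)).
exists k => h; rewrite tX !transport_permE.
have -> : f' (g + h) = (f' g * f' h)%g by apply: (can_inj fK); rewrite fM !f'K.
by rewrite sE ek fM.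
Qed.

Lemma skew_product_sub_AGL (gT : finGroupType) n (f : gT -> 'rV[F]_n) f'
    (fK : cancel f f') (f'K : cancel f' f) (s : {perm gT})
    (skew_s : skew_morphism s) :
  (forall g, transport_perm fK f'K (left_mul_perm g) \in AGL n p) ->
  transport_perm fK f'K s \in AGL n p ->
  exists H : {group {perm 'rV[F]_n}},
    H \subset AGL n p /\ (skew_product_group skew_s \isog H)%g.
Proof.
move=> Lg sA; exists (transport_morphism fK f'K @* skew_product_group skew_s)%G.
split; last exact: isog_transport.
apply/subsetP=> _ /morphimP[_ _ /mulsgP[_ y /imsetP[g _ ->] ys ->] ->].
rewrite morphM ?in_setT //; apply: (@groupM _ (AGL_group n p)); first exact: Lg.
by case/cycleP: ys => k ->; rewrite morphX ?in_setT //; exact: (@groupX _ (AGL_group n p)).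
Qed.

Lemma skew_product_affine n (gT : finGroupType) (s : {perm gT})
    (skew_s : skew_morphism s) : n = 2%N \/ n = 3%N ->
    ([set: gT] \isog [set: 'rV[F]_n])%g ->
  exists H : {group {perm 'rV[F]_n}},
    H \subset AGL n p /\ (skew_product_group skew_s \isog H)%g.
Proof.
move=> n23 /isogP[f injf imf].
have fM x y : f (x * y)%g = f x + f y by rewrite morphM ?inE.
have finj : injective f by move=> x y; apply: (injmP injf); rewrite inE.
have cardE : #|'rV[F]_n| = #|gT|.
  by rewrite -!cardsT -imf card_injm.
have [f' fK f'K] : bijective f by apply: inj_card_bij => //; rewrite cardE.
pose t := transport_perm fK f'K s.
have skew_t : askew t by exact: skew_transport.
have [[S tS]|[p2 [S [l [w [adm tE]]]]]] : linear_perm t \/ admissible_perm t.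
- by case: n23 => en; subst n; [apply: classify2 | apply: classify3].
- apply: (@skew_product_sub_AGL _ _ _ _ fK f'K) => [g|].
    apply: (@AGLP _ _ 1%:M (f g)); rewrite ?unitmx1 // => v.
    by rewrite transport_permE left_mul_permE fM f'K mulmx1 addrC.
  by apply: (@AGLP _ _ S 0) => [|v]; rewrite ?addr0 //; apply: linear_perm_unit tS.
have [[l0 w0 wl _] [mu [m0 m1 wS Sl]]] := admissibleP _ _ _ adm.
(* Conjugating by [phi] changes the coefficient of [l(v)^2 w] in [s] from 1 to [1 - d (mu - mu^2)],
   so this [d] makes [s] linear. *)
pose d := (mu - mu ^+ 2)^-1.
pose phi (v : 'rV[F]_n) := v + (d * sc v l ^+ 2) *: w.
pose psi (v : 'rV[F]_n) := v - (d * sc v l ^+ 2) *: w.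
have lphi v : sc (phi v) l = sc v l by rewrite scD scZ wl mulr0 addr0.
have lpsi v : sc (psi v) l = sc v l by rewrite scD scN scZ wl mulr0 subr0.
have phiK : cancel phi psi by move=> v; rewrite /psi lphi addrK.
have psiK : cancel psi phi by move=> v; rewrite /phi lpsi subrK.
apply: (@skew_product_sub_AGL _ _ _ _ (can_comp phiK fK) (can_comp f'K psiK)) => [g|].
  (* The translation by [f g] becomes affine: the cross term [2 d l(f g) l(v) w] of the square
     contributes the linear part. *)
  apply: (@AGLP _ _ (1%:M + (2%:R * d * sc (f g) l) *: (l *m w)) (phi (f g))).
    set c := _ * _; have wl0 : w *m l = 0 by rewrite scE wl raddf0.
    have : (1%:M + c *: (l *m w)) *m (1%:M - c *: (l *m w)) = 1%:M.
      rewrite mulmxDl mul1mx mulmxBr mulmx1 -scalemxAl -scalemxAr mulmxA -[l *m w *m l]mulmxA.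
      by rewrite wl0 mulmx0 mul0mx !scaler0 subr0 subrK.
    by case/mulmx1_unit.
  move=> v; rewrite transport_permE /= left_mul_permE fM f'K /phi scD lpsi /psi.
  rewrite mulmxDr mulmx1 -scalemxAr mul_outer.
  move: (sc (f g) l) (sc v l) (f g) => a b u.
  by apply/rowP=> q; rewrite !mxE; ring.
apply: (@AGLP _ _ S 0) => [|v]; first exact: admissible_unit adm.
have := tE (psi v); rewrite !transport_permE /= => ->.
rewrite /phi lpsi scD scM Sl scZr scZ wl mulr0 addr0 lpsi mulmxBl -scalemxAl wS addr0.
rewrite -!addrA -[RHS]addr0 -scaleNr !scalerA -!scalerDl; congr (_ + _).
rewrite (_ : _ + _ = 0) ?scale0r // /d; field.
by rewrite expr2 -{1}[mu]mulr1 -mulrBr mulf_neq0 // subr_eq0 eq_sym.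
Qed.

End Affine.

(** * Counting *)

Lemma card_dep_pairs (A B : finType) (P : pred A) (Q : A -> pred B) c :
    (forall x, P x -> #|[set y | Q x y]| = c) ->
  #|[set xy : A * B | P xy.1 && Q xy.1 xy.2]| = (#|[set x | P x]| * c)%N.
Proof.
move=> Qc; rewrite -sum1_card (eq_bigl (fun xy : A * B => P xy.1 && Q xy.1 xy.2)).
  rewrite -(pair_big_dep P Q (fun _ _ => 1%N)) /= -sum_nat_const.
  rewrite [RHS](eq_bigl P); last by move=> x; rewrite inE.
  apply: eq_bigr => x Px; rewrite -(Qc x Px) -sum1_card.
  by apply: eq_bigl => y; rewrite inE.
by move=> xy; rewrite inE.
Qed.

(* Junk value [1] unless [f] is injective. *)
Definition perm_of_fun (T : finType) (f : T -> T) : {perm T} :=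
  odflt 1%g [pick s : {perm T} | [forall v, s v == f v]].

Lemma perm_of_funE (T : finType) (f : T -> T) : injective f -> perm_of_fun f =1 f.
Proof.
move=> injf v; rewrite /perm_of_fun; case: pickP => [s /forallP/(_ v)/eqP//|].
by move/(_ (perm injf))/forallP; case=> x; rewrite permE.
Qed.

Section Counting.
Variable p : nat.
Hypothesis p_prime : prime p.
Local Notation F := 'F_p.

Definition linear_perms n : {set {perm 'rV[F]_n}} :=
  [set perm_of_fun (mulmx^~ S) | S in [set S : 'M[F]_n | S \in unitmx]].

(** The pair [(l, w)] comes first so that the count can fibre over it. *)
Definition admissible_triples n : {set ('cV[F]_n * 'rV[F]_n) * 'M[F]_n} :=
  [set t | admissible t.2 t.1.1 t.1.2].

Definition admissible_perms n : {set {perm 'rV[F]_n}} :=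
  [set perm_of_fun (quad_map t.2 t.1.1 t.1.2) | t in admissible_triples n].

Lemma linear_permsP n s : reflect (linear_perm s) (s \in linear_perms n).
Proof.
apply: (iffP imsetP) => [[S /[!inE] uS ->]|[S sE]].
  by exists S; apply: perm_of_funE; exact: can_inj (mulmxK uS).
have uS := linear_perm_unit sE; exists S; first by rewrite inE.
by apply/permP=> v; rewrite perm_of_funE ?sE //; exact: can_inj (mulmxK uS).
Qed.

Lemma card_linear_perms n : #|linear_perms n.+1| = #|'GL_n.+1[F]%g|.
Proof.
rewrite card_in_imset => [|S T /[!inE] uS uT /permP E].
  by rewrite cardsT card_sub; apply: eq_card => S; rewrite inE.
apply: mulmx_ext => v; have := E v.
by rewrite !perm_of_funE //; apply: can_inj; apply: mulmxK.
Qed.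

Lemma quad_map_odd n (S : 'M[F]_n) l w v :
  quad_map S l w v - quad_map S l w (- v) = v *m (2%:R *: S).
Proof.
rewrite /quad_map scN sqrrN mulNmx opprD opprK addrACA subrr addr0 -scalemxAr.
by rewrite scaler_nat mulr2n.
Qed.

Lemma quad_map_even n (S : 'M[F]_n) l w v :
  quad_map S l w v + quad_map S l w (- v) = (2%:R * sc v l ^+ 2) *: w.
Proof.
rewrite /quad_map scN sqrrN mulNmx addrACA subrr add0r -scalerDl.
by rewrite mulr_natl mulr2n.
Qed.

(** For odd p, the odd part of the map determines [S] and the even part [l(v)^2 w]. The power
    [S ^+ p.-1] also determines [l(v) w], and the two together recover [l] and [w]. *)
Lemma card_admissible_perms n : p <> 2%N ->
  #|admissible_perms n| = #|admissible_triples n|.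
Proof.
move=> p2; have nz2 := two_neq0 p_prime p2.
rewrite card_in_imset // => -[[l w] S] [[l' w'] S'] /[!inE] /= adm adm' /permP E.
have {}E v : quad_map S l w v = quad_map S' l' w' v.
  have := E v; rewrite !perm_of_funE //; apply: quad_map_inj => //.
have eS : S = S'.
  apply: (scalerI nz2); apply: mulmx_ext => v.
  by rewrite -(quad_map_odd S l w) -(quad_map_odd S' l' w') !E.
move: adm adm' E; rewrite {}eS => /admissibleP[[l0 w0 wl Sp] _].
move=> /admissibleP[[l0' w0' wl' Sp'] _] E.
have eq1 v : sc v l *: w = sc v l' *: w'.
  by rewrite -!mul_outer; congr (v *m _); apply: (@addrI _ 1); rewrite -Sp -Sp'.
have eq2 v : sc v l ^+ 2 *: w = sc v l' ^+ 2 *: w'.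
  by apply: (@addrI _ (v *m S')); exact: E.
have ll' : l = l'.
  apply: sc_inj => v; have [lv|lv] := eqVneq (sc v l) 0.
    have := eq1 v; rewrite lv scale0r => /esym/eqP; rewrite scaler_eq0 (negPf w0') orbF.
    by move/eqP.
  have := eq2 v; rewrite [in RHS]expr2 -scalerA -eq1 scalerA expr2 => /eqP.
  rewrite -subr_eq0 -scalerBl scaler_eq0 (negPf w0) orbF subr_eq0 => /eqP.
  exact: mulIf.
have [v lv] := sc_neq0 l0.
have := eq1 v; rewrite -ll' => /(scalerI lv) ->; by [].
Qed.

Lemma admissible_conj n (g S : 'M[F]_n) l w : g \in unitmx ->
  admissible S l w -> admissible (g *m S *m invmx g) (g *m l) (w *m invmx g).
Proof.
move=> gu /admissibleP[[l0 w0 wl Sp] [mu [m0 m1 wS Sl]]]; apply/admissibleP.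
have guV : invmx g \in unitmx by rewrite unitmx_inv.
split; [split|exists mu; split=> //].
- by apply: contraNneq l0 => gl; apply/eqP/(can_inj (mulKmx gu)); rewrite gl mulmx0.
- by apply: contraNneq w0 => gw; apply/eqP/(can_inj (mulmxK guV)); rewrite gw mul0mx.
- by rewrite scM mulKmx.
- by rewrite conjmxX // Sp mulmxDr mulmx1 mulmxDl mulmxV // !mulmxA.
- by rewrite !mulmxA mulmxKV // wS -scalemxAl.
- by rewrite -!mulmxA mulKmx // Sl -scalemxAr.
Qed.

Definition standard_fiber n : {set 'M[F]_n.+2} :=
  [set S | admissible S (delta_mx ord_max 0) (delta_mx 0 0)].

(** Conjugation by the matrix of [unitmx_pair] identifies the fibre with the standard one. *)
Lemma card_admissible_fiber n (l : 'cV[F]_n.+2) (w : 'rV_n.+2) :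
    l != 0 -> w != 0 -> sc w l = 0 ->
  #|[set S | admissible S l w]| = #|standard_fiber n|.
Proof.
move=> l0 w0 wl; have wl0 : w *m l = 0 by rewrite scE wl raddf0.
have [g gu [gw gl]] := unitmx_pair w0 l0 wl0.
have guV : invmx g \in unitmx by rewrite unitmx_inv.
have ew : delta_mx 0 0 = w *m invmx g by rewrite -gw mulmxK.
pose f (S : 'M[F]_n.+2) := g *m S *m invmx g.
have finj : injective f by move=> x y /(can_inj (mulmxK guV))/(can_inj (mulKmx gu)).
rewrite -[RHS](card_preimset _ finj); apply: eq_card => S; rewrite !inE -gl ew.
apply/idP/idP => [adm|adm]; first exact: (admissible_conj gu adm).
have := admissible_conj guV adm; rewrite invmxK (mulKmx gu) (mulmxKV gu).
by rewrite -[_ *m f S *m g]mulmxA (mulmxKV gu) (mulKmx gu).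
Qed.

Lemma card_orthogonal_pairs n :
  #|[set lw : 'cV[F]_n.+1 * 'rV[F]_n.+1 |
     (lw.1 != 0) && ((lw.2 != 0) && (sc lw.2 lw.1 == 0))]|
  = ((p ^ n.+1 - 1) * (p ^ n - 1))%N.
Proof.
rewrite (@card_dep_pairs _ _ (fun l : 'cV[F]_n.+1 => l != 0)
  (fun l (w : 'rV[F]_n.+1) => (w != 0) && (sc w l == 0)) (p ^ n - 1)); last first.
  move=> l l0; have <- : #|rowg (kermx l)| = (p ^ n)%N.
    rewrite card_rowg card_Fp // mxrank_ker -mxrank_tr rank_rV.
    by rewrite -trmx0 (inj_eq (@trmx_inj _ _ _)) l0 subn1.
  rewrite [in RHS](cardsD1 0) inE sub0mx addnC addnK; apply: eq_card => w; rewrite !inE.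
  congr andb; rewrite sub_kermx scE.
  by apply/eqP/eqP => [->|]; [exact: raddf0|move/matrixP/(_ 0 0); rewrite !mxE].
congr (_ * _)%N; have := cardsC [set 0 : 'cV[F]_n.+1].
rewrite cards1 card_mx card_Fp // muln1 => <-; rewrite addnC addnK.
by apply: eq_card => l; rewrite !inE.
Qed.

Lemma card_admissible_triples n :
  #|admissible_triples n.+2| = ((p ^ n.+2 - 1) * (p ^ n.+1 - 1) * #|standard_fiber n|)%N.
Proof.
rewrite -card_orthogonal_pairs -(@card_dep_pairs _ _
  (fun lw : 'cV[F]_n.+2 * 'rV[F]_n.+2 => (lw.1 != 0) && ((lw.2 != 0) && (sc lw.2 lw.1 == 0)))
  (fun lw (S : 'M[F]_n.+2) => admissible S lw.1 lw.2)).
  apply: eq_card => -[[l w] S]; rewrite !inE /=.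
  apply/idP/andP => [adm|[]//]; split=> //.
  by have [[-> -> -> _] _] := admissibleP _ _ _ adm; rewrite eqxx.
by move=> [l w] /= /and3P[l0 w0 /eqP wl]; exact: card_admissible_fiber.
Qed.

Lemma card_skip2 (a b : F) : a != b -> #|[set x | (x != a) && (x != b)]| = (p - 2)%N.
Proof.
move=> ab; have := cardsC [set a; b]; rewrite cards2 ab card_Fp // => e.
by rewrite -[X in (X - 2)%N]e addnC addnK; apply: eq_card => x; rewrite !inE negb_or.
Qed.

Lemma outer_delta2 : delta_mx ord_max (0 : 'I_1) *m delta_mx (0 : 'I_1) 0 = mx2 0 1 :> 'M[F]_2.
Proof.
apply/matrixP=> i j; rewrite mul_delta_mx !mxE.
by case: i => [[|[|i]] // hi]; case: j => [[|[|j]] // hj].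
Qed.

Lemma outer_delta3 :
  delta_mx ord_max (0 : 'I_1) *m delta_mx (0 : 'I_1) 0 = mx3 0 0 0 0 1 :> 'M[F]_3.
Proof.
apply/matrixP=> i j; rewrite mul_delta_mx !mxE.
by case: i => [[|[|[|i]]] // hi]; case: j => [[|[|[|j]]] // hj].
Qed.

Lemma delta_orthogonal n :
  [/\ delta_mx ord_max 0 != 0 :> 'cV[F]_n.+2, delta_mx 0 0 != 0 :> 'rV[F]_n.+2
     & sc (delta_mx 0 0 : 'rV[F]_n.+2) (delta_mx ord_max 0) = 0].
Proof.
split.
- by apply/eqP=> /matrixP/(_ ord_max 0)/eqP; rewrite !mxE !eqxx oner_eq0.
- by apply/eqP=> /matrixP/(_ 0 0)/eqP; rewrite !mxE !eqxx oner_eq0.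
- by rewrite /sc mul_delta_mx_0 ?mxE.
Qed.

Lemma mx2_rows (a e : F) : delta_mx 0 0 *m mx2 a e = a *: delta_mx 0 0 :> 'rV_2 /\
  mx2 a e *m delta_mx ord_max 0 = a *: delta_mx ord_max 0 :> 'cV_2.
Proof.
rewrite -rowE -colE; split; [apply/rowP|apply/colP]=> -[[|[|i]] // hi];
by rewrite !mxE /= ?mulr1 ?mulr0.
Qed.

Lemma mx3_rows (a n b c e : F) :
  delta_mx 0 0 *m mx3 a n b c e = a *: delta_mx 0 0 :> 'rV_3 /\
  mx3 a n b c e *m delta_mx ord_max 0 = a *: delta_mx ord_max 0 :> 'cV_3.
Proof.
rewrite -rowE -colE; split; [apply/rowP|apply/colP]=> -[[|[|[|i]]] // hi];
by rewrite !mxE /= ?mulr1 ?mulr0.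
Qed.

Lemma mx2D1 (e : F) : 1 + mx2 0 e = mx2 1 e.
Proof.
apply/matrixP=> i j; rewrite !mxE.
by case: i => [[|[|i]] // hi]; case: j => [[|[|j]] // hj]; rewrite /= ?addr0 ?add0r.
Qed.

Lemma mx3D1 (e : F) : 1 + mx3 0 0 0 0 e = mx3 1 1 0 0 e.
Proof.
apply/matrixP=> i j; rewrite !mxE.
by case: i => [[|[|[|i]]] // hi]; case: j => [[|[|[|j]]] // hj]; rewrite /= ?addr0 ?add0r.
Qed.

Lemma pred_coef (mu : F) : mu != 0 -> p.-1%:R * mu ^+ p.-2 = - mu^-1.
Proof.
move=> m0; rewrite natr_pred // mulN1r; congr (- _); apply: (mulfI m0).
rewrite mulfV // -exprS prednK; last by rewrite -ltnS prednK ?prime_gt1 ?prime_gt0.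
exact: Fp_exp_pred.
Qed.

(** For [S = mx2 mu e] the corner entry of [S ^+ p.-1] is [- e / mu], and it must be 1; only [mu],
    different from 0 and 1, is free. *)
Lemma card_standard_fiber2 : #|standard_fiber 0| = (p - 2)%N.
Proof.
have [d0 d1 d2] := delta_orthogonal 0.
rewrite -(@card_skip2 0 1) ?(eq_sym 0) ?oner_eq0 //.
rewrite -(@card_imset _ _ (fun mu : F => mx2 mu (- mu))); last by move=> x y /mx2_inj[].
apply: eq_card => S; rewrite inE; apply/admissibleP/imsetP.
  case=> [[_ _ _ Sp] [mu [m0 m1 wS Sl]]]; exists mu; first by rewrite inE m0 m1.
  have [e eS] := mx2P wS Sl; rewrite eS; congr mx2.
  move: Sp; rewrite eS mx2X Fp_exp_pred // outer_delta2 mx2D1 => /mx2_inj[_].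
  rewrite pred_coef // mulrN => /(congr1 (fun x => - x * mu)).
  by rewrite opprK mulfVK // mulN1r.
case=> mu /[!inE] /andP[m0 m1] ->; split; last first.
  by exists mu; have [] := mx2_rows mu (- mu).
split=> //; rewrite mx2X Fp_exp_pred // outer_delta2 mx2D1 pred_coef //.
by rewrite mulrNN mulfV.
Qed.

(** If [mu] differs from [nu], the entries [hcoef] vanish at [p.-1] and [b], [c] are free. If
    [mu = nu], they equal [- mu^-1] and force [b = c = 0]. *)
Lemma card_standard_fiber3 :
  #|standard_fiber 1| = ((p - 2) * (p ^ 2 * (p - 2) + 1))%N.
Proof.
have [d0 d1 d2] := delta_orthogonal 1.
pose par := [set q : (F * F) * (F * F) | [&& (q.1.1 != 0) && (q.1.1 != 1), q.1.2 != 0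
   & (q.1.1 != q.1.2) || (q.2 == 0)]].
pose k := p.-1.
(* The corner entry [e] is the solution of [- e / mu + b c g = 1], with [g] the value of [gcoef]. *)
pose f (q : (F * F) * (F * F)) := mx3 q.1.1 q.1.2 q.2.1 q.2.2
  (q.1.1 * (q.2.1 * q.2.2 * gcoef q.1.1 q.1.2 k - 1)).
have -> : #|standard_fiber 1| = #|par|.
  rewrite -(@card_imset _ _ f); last first.
    by move=> [[a b] [c d]] [[a' b'] [c' d']] /mx3_inj[/= -> -> -> -> _].
  apply: eq_card => S; rewrite inE; apply/admissibleP/imsetP.
    case=> [[_ _ _ Sp] [mu [m0 m1 wS Sl]]].
    have [nu [b [c [e eS]]]] := mx3P wS Sl.
    move: Sp; rewrite eS mx3X Fp_exp_pred // outer_delta3 mx3D1 pred_coef //.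
    move=> /mx3_inj[_ nu1 hb hc he].
    exists ((mu, nu), (b, c)); last first.
      rewrite /f /=; congr mx3; move: he => /(congr1 (fun x => (b * c * gcoef mu nu k - x) * mu)).
      rewrite -/k => h.
      transitivity ((b * c * gcoef mu nu k - (e * - mu^-1 + b * c * gcoef mu nu k)) * mu).
        by field.
      by rewrite h mulrC.
    rewrite inE /= m0 m1 /=; apply/andP; split.
      have p0 : (p.-1 == 0%N) = false.
        by apply/negbTE; rewrite -lt0n -ltnS prednK ?prime_gt0 ?prime_gt1.
      by apply: contra_eq_neq nu1 => ->; rewrite expr0n p0 eq_sym oner_eq0.
    have [e1|//] := eqVneq mu nu; move: hb hc; rewrite -e1 !hcoef_diag pred_coef //=.
    have i0 : - mu^-1 != 0 by rewrite oppr_eq0 invr_eq0.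
    by move=> /eqP hb /eqP hc; move: hb hc; rewrite !mulf_eq0 (negPf i0) !orbF xpair_eqE => -> ->.
  case=> -[[mu nu] [b c]] /[!inE] /= /and3P[/andP[m0 m1] n0 mn] ->; split; last first.
    by exists mu; have [] := mx3_rows mu nu b c (mu * (b * c * gcoef mu nu k - 1)).
  split=> //; rewrite mx3X !Fp_exp_pred // outer_delta3 mx3D1 pred_coef // -/k.
  have [hb hc] : b * hcoef mu nu k = 0 /\ c * hcoef nu mu k = 0.
    have [e1|ne] := eqVneq mu nu.
      by move: mn; rewrite e1 eqxx /= xpair_eqE => /andP[/eqP-> /eqP->]; rewrite !mul0r.
    have h (x y : F) : x != 0 -> y != 0 -> x != y -> hcoef x y k = 0.
      move=> x0 y0 xy; have := hcoef_sub x y k; rewrite !Fp_exp_pred // subrr => /eqP.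
      by rewrite mulf_eq0 subr_eq0 (negPf xy) orbF => /eqP.
    by rewrite !h ?mulr0 // eq_sym.
  by rewrite hb hc; congr mx3; field.
have -> : #|par| = (#|[set q in par | q.1.1 != q.1.2]| + #|[set q in par | q.1.1 == q.1.2]|)%N.
  rewrite -(cardsID [set q | q.1.1 != q.1.2] par); congr (_ + _)%N; apply: eq_card => q.
    by rewrite !inE.
  by rewrite !inE negbK andbC.
have cF2 : #|[set q : F * F | true]| = (p ^ 2)%N.
  by rewrite cardsT card_prod card_Fp // mulnn.
have cF1 : #|[set q : F * F | q == 0]| = 1%N.
  by rewrite -(cards1 (0 : F * F)); apply: eq_card => q; rewrite !inE.
rewrite mulnDr muln1; congr (_ + _)%N.
  pose P (mn : F * F) := ((mn.1 != 0) && (mn.1 != 1)) && ((mn.2 != 0) && (mn.2 != mn.1)).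
  have cP : #|[set mn | P mn]| = ((p - 2) * (p - 2))%N.
    rewrite (@card_dep_pairs _ _ (fun m : F => (m != 0) && (m != 1))
      (fun m n : F => (n != 0) && (n != m)) (p - 2)); last first.
      by move=> m /andP[m0 _]; rewrite card_skip2 // eq_sym.
    by rewrite card_skip2 // eq_sym oner_eq0.
  transitivity #|[set q : (F * F) * (F * F) | P q.1 && true]|.
    apply: eq_card => -[[mu nu] q]; rewrite !inE /P /= andbT (eq_sym nu mu).
    by case: (mu == nu); rewrite /= ?(andbT, andbF).
  by rewrite (@card_dep_pairs _ _ P (fun _ _ => true) (p ^ 2)) // cP -mulnA [(_ * p ^ 2)%N]mulnC.
pose P (mn : F * F) := ((mn.1 != 0) && (mn.1 != 1)) && (mn.2 == mn.1).
have cP : #|[set mn | P mn]| = (p - 2)%N.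
  rewrite (@card_dep_pairs _ _ (fun m : F => (m != 0) && (m != 1))
    (fun m n : F => n == m) 1); last first.
    by move=> m _; rewrite -(cards1 m); apply: eq_card => x; rewrite !inE.
  by rewrite muln1 card_skip2 // eq_sym oner_eq0.
transitivity #|[set q : (F * F) * (F * F) | P q.1 && (q.2 == 0)]|.
  apply: eq_card => -[[mu nu] q]; rewrite !inE /P /= (eq_sym nu mu).
  have [<-|_] := eqVneq mu nu; rewrite /= ?(andbT, andbF) //.
  by case: (mu == 0); rewrite /= ?andbT.
rewrite -[RHS]muln1 -cP; apply: (@card_dep_pairs _ _ P (fun _ (q : F * F) => q == 0)).
by move=> *; exact: cF1.
Qed.

Lemma skew_morphisms_classified n : n = 2%N \/ n = 3%N -> p <> 2%N ->
  #|skew_morphisms 'rV[F]_n| = (#|linear_perms n| + #|admissible_triples n|)%N.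
Proof.
move=> n23 p2; rewrite -card_admissible_perms //.
have nz2 := two_neq0 p_prime p2.
have -> : skew_morphisms 'rV[F]_n = linear_perms n :|: admissible_perms n.
  apply/setP=> s; rewrite !inE; apply/asboolP/orP.
    move=> /askewP skew_s.
    have [lin|[_ [S [l [w [adm sE]]]]]] : linear_perm s \/ admissible_perm s.
    - by case: n23 => en; subst n; [apply: classify2 | apply: classify3].
    - by left; apply/linear_permsP.
    right; apply/imsetP; exists ((l, w), S); first by rewrite inE.
    by apply/permP=> v; rewrite perm_of_funE ?sE //; exact: quad_map_inj adm.
  case=> [/linear_permsP[S sE]|/imsetP[[[l w] S] /[!inE] /= adm ->]]; apply/askewP.
    exact: linear_skew sE.
  by apply: (admissible_skew p_prime adm) => v; rewrite perm_of_funE //; exact: quad_map_inj adm.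
rewrite cardsU.
(* A linear map is odd, whereas the even part of an admissible one is a nonzero multiple of
   [l(v)^2 w]. *)
have -> : linear_perms n :&: admissible_perms n = set0; last by rewrite cards0 subn0.
apply/setP=> s; rewrite in_setI in_set0; apply/negbTE/negP=> /andP[].
case/linear_permsP=> T sT /imsetP[[[l w] S] /[!inE] /= adm es].
have [[l0 w0 _ _] _] := admissibleP _ _ _ adm; have [v lv] := sc_neq0 l0.
have sE u : s u = quad_map S l w u.
  by rewrite es perm_of_funE //; exact: quad_map_inj adm.
have /eqP := quad_map_even S l w v; rewrite -!sE !sT mulNmx subrr eq_sym.
by rewrite scaler_eq0 (negPf w0) orbF mulf_eq0 (negPf nz2) expf_eq0 (negPf lv).
Qed.

Lemma skew_morphisms_linear n : n = 1%N \/ p = 2%N /\ (n = 2%N \/ n = 3%N) ->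
  skew_morphisms 'rV[F]_n = linear_perms n.
Proof.
move=> nP; apply/setP=> s; rewrite inE.
apply/asboolP/linear_permsP => [/askewP skew_s|[S /linear_skew skew_s]]; last exact/askewP.
case: nP => [en|[p2 [en|en]]]; subst n.
- exact: skew_linear1.
- by case: (classify2 p_prime skew_s) => // -[].
- by case: (classify3 p_prime skew_s) => // -[].
Qed.

End Counting.

(** * Arithmetic of the final counts, with truncated subtraction removed by shifting [q] by 2 *)

Lemma skew_count_arith2 q : (2 <= q)%N ->
  (q * q.-1 ^ 2 * q.+1 + (q ^ 2 - 1) * (q ^ 1 - 1) * (q - 2)
   = 2 * (q + 1) * (q - 1) ^ 3)%N.
Proof.
case: q => [|[|q]] // _; rewrite -[q.+2.-1]/q.+1 expn1.
have -> : (q.+2 ^ 2 - 1 = q.+1 * q.+3)%N.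
  by apply: (canLR (addnK 1)); rewrite -!mulnn; ring.
rewrite !subn1 !subn2 /=; ring.
Qed.

Lemma skew_count_arith3 q : (2 <= q)%N ->
  (q ^ 3 * ((q - 1) * (q ^ 2 - 1) * (q ^ 3 - 1))
    + (q ^ 3 - 1) * (q ^ 2 - 1) * ((q - 2) * (q ^ 2 * (q - 2) + 1))
   = (q ^ 3 - 1) * (q ^ 2 - 1) * (q - 1) * (2 * q ^ 3 - 3 * q ^ 2 + q + 2))%N.
Proof.
case: q => [|[|q]] // _; set A := (q.+2 ^ 3 - 1)%N; set B := (q.+2 ^ 2 - 1)%N.
have -> : (2 * q.+2 ^ 3 - 3 * q.+2 ^ 2 = q.+2 ^ 2 * (2 * q + 1))%N.
  by apply: (canLR (addnK _)); rewrite !expnS expn0; ring.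
rewrite !subn1 !subn2 /=; ring.
Qed.

Local Close Scope ring_scope.

Theorem theorem1p2 (p : nat) (p_prime : prime p) :
  (forall (n : nat), n = 2 \/ n = 3 ->
   forall (gT : finGroupType), [set: gT] \isog [set: 'rV['F_p]_n] ->
   forall (s : {perm gT}) (skew_s : skew_morphism s),
   exists H : {group {perm 'rV['F_p]_n}},
     H \subset AGL n p /\ skew_product_group skew_s \isog H)
  /\
  ((p = 2 ->
      #|skew_morphisms 'rV['F_p]_1| = 1 /\
      #|skew_morphisms 'rV['F_p]_2| = 6 /\
      #|skew_morphisms 'rV['F_p]_3| = 168) /\
   (p <> 2 ->
      #|skew_morphisms 'rV['F_p]_1| = p - 1 /\
      #|skew_morphisms 'rV['F_p]_2| = 2 * (p + 1) * (p - 1) ^ 3 /\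
      #|skew_morphisms 'rV['F_p]_3| =
        (p ^ 3 - 1) * (p ^ 2 - 1) * (p - 1)
          * (2 * p ^ 3 - 3 * p ^ 2 + p + 2))).
Proof.
have p2 := prime_gt1 p_prime.
have lin1 : #|linear_perms p 1| = p - 1.
  by rewrite card_linear_perms card_GL_1 card_Fp // subn1.
have lin2 : #|linear_perms p 2| = p * p.-1 ^ 2 * p.+1.
  by rewrite card_linear_perms card_GL_2 card_Fp.
have lin3 : #|linear_perms p 3| = p ^ 3 * ((p - 1) * (p ^ 2 - 1) * (p ^ 3 - 1)).
  rewrite card_linear_perms card_GL // card_Fp //; congr (_ * _).
  by rewrite big_ltn // big_ltn // big_ltn // big_geq // muln1 expn1 mulnA.
have skew1 : #|skew_morphisms 'rV['F_p]_1| = p - 1.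
  by rewrite -lin1 (@skew_morphisms_linear p p_prime 1) //; left.
split=> [n n23 gT isoG s skew_s|]; first exact: skew_product_affine.
split=> [e|odd_p]; split=> //.
- by rewrite skew1 e.
- have lin n : n = 2 \/ n = 3 -> skew_morphisms 'rV['F_p]_n = linear_perms p n.
    by move=> n23; apply: (skew_morphisms_linear p_prime); right.
  by rewrite !lin; [rewrite lin2 lin3 e | right | left].
- have E n : n = 2 \/ n = 3 -> #|skew_morphisms 'rV['F_p]_n|
      = #|linear_perms p n| + #|admissible_triples p n|.
    by move=> n23; exact: skew_morphisms_classified.
  rewrite E; last by left.
  rewrite E; last by right.
  rewrite lin2 lin3 !(card_admissible_triples p_prime) card_standard_fiber2 //.
  by rewrite card_standard_fiber3 // skew_count_arith2 // skew_count_arith3.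
Qed.
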